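(* The tableaux algorithm obtained by adding the rule $SA(R_\Box,R_\Diamond,b)$ (from $bR_\Box y$ infer $yR_\Diamond b$) (resp. $SX(R_\Diamond,R_\Box,y)$: from $yR_\Diamond b$ infer $bR_\Box y$) to the LE-$\mathcal{ALC}$ tableaux expansion rules provides a polynomial-time sound and complete decision procedure for checking the consistency of $\mathcal{A}\cup\{\forall p\,(bR_\Box p \Rightarrow pR_\Diamond b)\}$ (resp. $\mathcal{A}\cup\{\forall p\,(yR_\Diamond p \Rightarrow pR_\Box y)\}$), for an LE-$\mathcal{ALC}$ ABox $\mathcal{A}$ and an object $b$ (resp. feature $y$) appearing in it.
   Context: LE-$\mathcal{ALC}$ is a two-sorted description logic over enriched formal contexts $(A,X,I,R_\Box,R_\Diamond)$, $I,R_\Box\subseteq A\times X$, $R_\Diamond\subseteq X\times A$. Concepts: $D \mid C_1\wedge C_2 \mid C_1\vee C_2 \mid \langle R_\Diamond\rangle C \mid [R_\Box]C$ (written $\Diamond C$, $\Box C$). ABox terms: $aR_\Box x$, $xR_\Diamond a$, $aIx$, $a:C$, $x::C$ and their negations; a clash is the presence of $\beta$ and $\neg\beta$ for a relational term $\beta$. The LE-$\mathcal{ALC}$ tableaux algorithm (non-branching; reports inconsistency iff a clash appears) uses the rules: creation (for each $C\in\mathcal{A}$ add $a_C:C$, $x_C::C$); basic ($b:C$, $y::C$ give $bIy$); $\wedge_A$, $\vee_X$ and their inverses (inverses only for meets/joins occurring in $\mathcal{A}$); $\Box$ ($b:[R_\Box]C$, $y::C$ give $bR_\Box y$); $\Diamond$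 ($y::\langle R_\Diamond\rangle C$, $b:C$ give $yR_\Diamond b$); adjunction ($bR_\Box y$ gives $\mathrm{L}_\Box b\,I\,y$ and $bI\Box y$; $yR_\Diamond b$ gives $\Diamond bIy$ and $bI\blacksquare y$, new individual names except $\Diamond a_C=a_{\Diamond C}$, $\Box x_C=x_{\Box C}$); $I$-compatibility ($bI\Box y$ or $\mathrm{L}_\Box b\,I\,y$ gives $bR_\Box y$; $bI\blacksquare y$ or $\Diamond bIy$ gives $yR_\Diamond b$); negative ($\neg(b:C)$ gives $\neg(bIx_C)$, $\neg(y::C)$ gives $\neg(a_CIy)$); appending ($bIx_C$ gives $b:C$, $a_CIy$ gives $y::C$). $\mathrm{L}_\Box$ is the left adjoint of $\Box$ (black lozenge in the paper), $\blacksquare$ the right adjoint of $\Diamond$. *)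

(* Defs.v *)
From HB Require Import structures.
From mathcomp Require Import all_boot.
From mathcomp Require Import boolp classical_sets.

Set Implicit Arguments.
Unset Strict Implicit.
Unset Printing Implicit Defensive.

Local Open Scope classical_set_scope.

Inductive concept (CN : Type) : Type :=
| Atom of CN
| Meet of concept CN & concept CN
| Join of concept CN & concept CN
| Dia of concept CN
| Box of concept CN.

(* O and F are the types of object names and of feature names.  They are
   parameters because an ABox given as input uses the individual names of the
   language only, whereas the tableau also uses the names that its rules
   generate. *)
Inductive term (CN O F : Type) : Type :=
| RBox of O & F               (* b R_Box y *)
| RDia of F & O               (* y R_Dia b *)
| Inc of O & F                (* b I y *)
| OIn of O & concept CN       (* b : C *)
| FIn of F & concept CN.      (* y :: C *)
Arguments RBox {CN O F}.
Arguments RDia {CN O F}.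
Arguments Inc {CN O F}.
Arguments OIn {CN O F}.
Arguments FIn {CN O F}.

Inductive assertion (CN O F : Type) : Type :=
| Pos of term CN O F
| Neg of term CN O F.
Arguments Pos {CN O F}.
Arguments Neg {CN O F}.

Notation abox CN O F := (seq (assertion CN O F)).

Definition concept_comparable (CN : eqType) : comparable (concept CN).
Proof. move=> C D; rewrite /decidable; decide equality; exact: eq_comparable. Defined.
HB.instance Definition _ (CN : eqType) :=
  hasDecEq.Build (concept CN) (compareP (@concept_comparable CN)).

Definition term_comparable (CN O F : eqType) : comparable (term CN O F).
Proof. move=> s t; rewrite /decidable; decide equality; exact: eq_comparable. Defined.
HB.instance Definition _ (CN O F : eqType) :=
  hasDecEq.Build (term CN O F) (compareP (@term_comparable CN O F)).

Definition assertion_comparable (CN O F : eqType) : comparable (assertion CN O F).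
Proof. move=> s t; rewrite /decidable; decide equality; exact: eq_comparable. Defined.
HB.instance Definition _ (CN O F : eqType) :=
  hasDecEq.Build (assertion CN O F) (compareP (@assertion_comparable CN O F)).

Definition relational (CN O F : Type) (t : term CN O F) : bool :=
  match t with RBox _ _ | RDia _ _ | Inc _ _ => true | _ => false end.

Definition body (CN O F : Type) (t : assertion CN O F) : term CN O F :=
  match t with Pos u | Neg u => u end.

Definition term_obj (CN O F : Type) (t : term CN O F) : seq O :=
  match t with
  | RBox b _ | RDia _ b | Inc b _ | OIn b _ => [:: b]
  | FIn _ _ => [::]
  end.

Definition term_feat (CN O F : Type) (t : term CN O F) : seq F :=
  match t with
  | RBox _ y | RDia y _ | Inc _ y | FIn y _ => [:: y]
  | OIn _ _ => [::]
  end.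

Definition obj_occurs (CN O F : eqType) (b : O) (A : abox CN O F) : bool :=
  has (fun t => b \in term_obj (body t)) A.

Definition feat_occurs (CN O F : eqType) (y : F) (A : abox CN O F) : bool :=
  has (fun t => y \in term_feat (body t)) A.

Fixpoint subconcepts (CN : Type) (C : concept CN) : seq (concept CN) :=
  C :: match C with
       | Atom _ => [::]
       | Meet C1 C2 | Join C1 C2 => subconcepts C1 ++ subconcepts C2
       | Dia C1 | Box C1 => subconcepts C1
       end.

Definition term_concepts (CN O F : Type) (t : term CN O F) : seq (concept CN) :=
  match t with
  | OIn _ C | FIn _ C => subconcepts C
  | _ => [::]
  end.

(* The concepts C with C "in" A: the subconcepts of the concepts of the
   (positive or negative) assertions of A. *)
Definition concepts (CN O F : Type) (A : abox CN O F) : seq (concept CN) :=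
  flatten [seq term_concepts (body t) | t <- A].

(* R^(1)[B] and R^(0)[Y]; with R the incidence relation these are the two maps
   of the Galois connection of a formal context. *)
Definition rel1 (U V : Type) (R : U -> V -> Prop) (B : set U) : set V :=
  [set v | forall u, B u -> R u v].
Definition rel0 (U V : Type) (R : U -> V -> Prop) (Y : set V) : set U :=
  [set u | forall v, Y v -> R u v].

Definition stable_obj (U V : Type) (I : U -> V -> Prop) (B : set U) : Prop :=
  rel0 I (rel1 I B) = B.
Definition stable_feat (U V : Type) (I : U -> V -> Prop) (Y : set V) : Prop :=
  rel1 I (rel0 I Y) = Y.

(* The four last fields are the I-compatibility of R_Box and R_Dia. *)
Record enriched_context : Type := EnrichedContext {
  obj : Type;
  feat : Type;
  inc : obj -> feat -> Prop;
  rbox : obj -> feat -> Prop;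
  rdia : feat -> obj -> Prop;
  rbox0_stable : forall x, stable_obj inc (rel0 rbox [set x]);
  rbox1_stable : forall a, stable_feat inc (rel1 rbox [set a]);
  rdia0_stable : forall a, stable_feat inc (rel0 rdia [set a]);
  rdia1_stable : forall x, stable_obj inc (rel1 rdia [set x])
}.

Record formal_concept (P : enriched_context) : Type := FormalConcept {
  extent : set (obj P);
  intent : set (feat P);
  extentK : rel1 (@inc P) extent = intent;
  intentK : rel0 (@inc P) intent = extent
}.

Section ComplexAlgebra.
Variable P : enriched_context.
Local Notation I := (@inc P).
Implicit Types (c d : formal_concept P).

Lemma sub_rel01 B : B `<=` rel0 I (rel1 I B).
Proof. by move=> a Ba x; apply. Qed.

Lemma sub_rel10 Y : Y `<=` rel1 I (rel0 I Y).
Proof. by move=> x Yx a; apply. Qed.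

Lemma rel0_rel10 Y : rel0 I (rel1 I (rel0 I Y)) = rel0 I Y.
Proof.
by apply/seteqP; split=> [a h x Yx|]; [apply: h; apply: sub_rel10|apply: sub_rel01].
Qed.

Lemma rel1_rel01 B : rel1 I (rel0 I (rel1 I B)) = rel1 I B.
Proof.
by apply/seteqP; split=> [x h a Ba|]; [apply: h; apply: sub_rel01|apply: sub_rel10].
Qed.

Lemma meet_stable c d : stable_obj I (extent c `&` extent d).
Proof.
apply/seteqP; split; last exact: sub_rel01.
by move=> a h; split; rewrite -intentK => x xc; apply: h => b [bc bd];
  [move: bc|move: bd]; rewrite -intentK; apply.
Qed.

Lemma join_stable c d : stable_feat I (intent c `&` intent d).
Proof.
apply/seteqP; split; last exact: sub_rel10.
by move=> x h; split; rewrite -extentK => a ac; apply: h => y [yc yd];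
  [move: yc|move: yd]; rewrite -extentK; apply.
Qed.

Lemma rbox_stable Y : stable_obj I (rel0 (@rbox P) Y).
Proof.
apply/seteqP; split; last exact: sub_rel01.
move=> a h x Yx; suff: rel0 (@rbox P) [set x] a by apply.
rewrite -rbox0_stable => z zx; apply: h => b hb; apply: zx.
by move=> _ ->; apply: hb.
Qed.

Lemma rdia_stable B : stable_feat I (rel0 (@rdia P) B).
Proof.
apply/seteqP; split; last exact: sub_rel10.
move=> x h a Ba; suff: rel0 (@rdia P) [set a] x by apply.
rewrite -rdia0_stable => b bx; apply: h => y hy; apply: bx.
by move=> _ ->; apply: hy.
Qed.

Definition fc_meet c d : formal_concept P := FormalConcept erefl (meet_stable c d).
Definition fc_join c d : formal_concept P := FormalConcept (join_stable c d) erefl.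
Definition fc_box c : formal_concept P :=
  FormalConcept erefl (rbox_stable (intent c)).
Definition fc_dia c : formal_concept P :=
  FormalConcept (rdia_stable (extent c)) erefl.

End ComplexAlgebra.

Record interpretation (CN ON FN : Type) : Type := Interpretation {
  ctx : enriched_context;
  iobj : ON -> obj ctx;
  ifeat : FN -> feat ctx;
  iatom : CN -> formal_concept ctx
}.

Fixpoint iconcept (CN ON FN : Type) (M : interpretation CN ON FN)
    (C : concept CN) : formal_concept (ctx M) :=
  match C with
  | Atom D => iatom M D
  | Meet C1 C2 => fc_meet (iconcept M C1) (iconcept M C2)
  | Join C1 C2 => fc_join (iconcept M C1) (iconcept M C2)
  | Dia C1 => fc_dia (iconcept M C1)
  | Box C1 => fc_box (iconcept M C1)
  end.

Definition sat_term (CN ON FN : Type) (M : interpretation CN ON FN)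
    (t : term CN ON FN) : Prop :=
  match t with
  | RBox a x => rbox (iobj M a) (ifeat M x)
  | RDia x a => rdia (ifeat M x) (iobj M a)
  | Inc a x => inc (iobj M a) (ifeat M x)
  | OIn a C => extent (iconcept M C) (iobj M a)
  | FIn x C => intent (iconcept M C) (ifeat M x)
  end.

Definition sat (CN ON FN : Type) (M : interpretation CN ON FN)
    (t : assertion CN ON FN) : Prop :=
  match t with
  | Pos u => sat_term M u
  | Neg u => ~ sat_term M u
  end.

Inductive separation (ON FN : Type) : Type :=
| SA of ON
| SX of FN.
Arguments SA {ON FN}.
Arguments SX {ON FN}.

(* forall p, b R_Box p => p R_Dia b, resp. forall p, y R_Dia p => p R_Box y;
   p ranges over all features, resp. objects, of the context. *)
Definition sat_separation (CN ON FN : Type) (M : interpretation CN ON FN)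
    (s : separation ON FN) : Prop :=
  match s with
  | SA b => forall p, rbox (iobj M b) p -> rdia p (iobj M b)
  | SX y => forall p, rdia (ifeat M y) p -> rbox p (ifeat M y)
  end.

Definition consistent (CN ON FN : eqType) (A : abox CN ON FN)
    (s : separation ON FN) : Prop :=
  exists M : interpretation CN ON FN,
    (forall t, t \in A -> sat M t) /\ sat_separation M s.

(* a_C is OCls C, x_C is FCls C; OLBox is the left adjoint of Box and FBlk the
   right adjoint of Dia.  Dia b and Box y are built with [odia] and [fbox],
   which identify Dia a_C with a_(Dia C) and Box x_C with x_(Box C); ODia
   (OCls C) and FBox (FCls C) are never generated. *)
Inductive oname (CN ON : Type) : Type :=
| ONam of ON
| OCls of concept CN
| ODia of oname CN ON
| OLBox of oname CN ON.
Arguments ONam {CN ON}.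
Arguments OCls {CN ON}.

Inductive fname (CN FN : Type) : Type :=
| FNam of FN
| FCls of concept CN
| FBox of fname CN FN
| FBlk of fname CN FN.
Arguments FNam {CN FN}.
Arguments FCls {CN FN}.

Definition oname_comparable (CN ON : eqType) : comparable (oname CN ON).
Proof. move=> a b; rewrite /decidable; decide equality; exact: eq_comparable. Defined.
HB.instance Definition _ (CN ON : eqType) :=
  hasDecEq.Build (oname CN ON) (compareP (@oname_comparable CN ON)).

Definition fname_comparable (CN FN : eqType) : comparable (fname CN FN).
Proof. move=> x y; rewrite /decidable; decide equality; exact: eq_comparable. Defined.
HB.instance Definition _ (CN FN : eqType) :=
  hasDecEq.Build (fname CN FN) (compareP (@fname_comparable CN FN)).

Definition odia (CN ON : Type) (b : oname CN ON) : oname CN ON :=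
  if b is OCls C then OCls (Dia C) else ODia b.

Definition fbox (CN FN : Type) (y : fname CN FN) : fname CN FN :=
  if y is FCls C then FCls (Box C) else FBox y.

Notation tabox CN ON FN := (abox CN (oname CN ON) (fname CN FN)).

Definition embed_term (CN ON FN : Type) (t : term CN ON FN) :
    term CN (oname CN ON) (fname CN FN) :=
  match t with
  | RBox a x => RBox (ONam a) (FNam x)
  | RDia x a => RDia (FNam x) (ONam a)
  | Inc a x => Inc (ONam a) (FNam x)
  | OIn a C => OIn (ONam a) C
  | FIn x C => FIn (FNam x) C
  end.

Definition embed (CN ON FN : Type) (A : abox CN ON FN) : tabox CN ON FN :=
  [seq match t with Pos u => Pos (embed_term u) | Neg u => Neg (embed_term u) end
  | t <- A].

Definition clash (CN O F : eqType) (A : abox CN O F) : Prop :=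
  exists t, [/\ relational t, Pos t \in A & Neg t \in A].

(* [rule s A new]: some instance of an expansion rule, with premises in A, has
   the conclusions new.  In the side conditions A is the current ABox. *)
Inductive rule (CN ON FN : eqType) (s : separation ON FN) (A : tabox CN ON FN) :
    tabox CN ON FN -> Prop :=
| rule_creation C : C \in concepts A ->
    rule s A [:: Pos (OIn (OCls C) C); Pos (FIn (FCls C) C)]
| rule_basic b y C : Pos (OIn b C) \in A -> Pos (FIn y C) \in A ->
    rule s A [:: Pos (Inc b y)]
| rule_meet b C1 C2 : Pos (OIn b (Meet C1 C2)) \in A ->
    rule s A [:: Pos (OIn b C1); Pos (OIn b C2)]
| rule_join y C1 C2 : Pos (FIn y (Join C1 C2)) \in A ->
    rule s A [:: Pos (FIn y C1); Pos (FIn y C2)]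
| rule_meet_inv b C1 C2 : Pos (OIn b C1) \in A -> Pos (OIn b C2) \in A ->
    Meet C1 C2 \in concepts A ->
    rule s A [:: Pos (OIn b (Meet C1 C2))]
| rule_join_inv y C1 C2 : Pos (FIn y C1) \in A -> Pos (FIn y C2) \in A ->
    Join C1 C2 \in concepts A ->
    rule s A [:: Pos (FIn y (Join C1 C2))]
| rule_box b y C : Pos (OIn b (Box C)) \in A -> Pos (FIn y C) \in A ->
    rule s A [:: Pos (RBox b y)]
| rule_dia b y C : Pos (FIn y (Dia C)) \in A -> Pos (OIn b C) \in A ->
    rule s A [:: Pos (RDia y b)]
| rule_adj_box b y : Pos (RBox b y) \in A ->
    rule s A [:: Pos (Inc (OLBox b) y); Pos (Inc b (fbox y))]
| rule_adj_dia b y : Pos (RDia y b) \in A ->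
    rule s A [:: Pos (Inc (odia b) y); Pos (Inc b (FBlk y))]
| rule_comp_fbox b y : Pos (Inc b (fbox y)) \in A ->
    rule s A [:: Pos (RBox b y)]
| rule_comp_lbox b y : Pos (Inc (OLBox b) y) \in A ->
    rule s A [:: Pos (RBox b y)]
| rule_comp_blk b y : Pos (Inc b (FBlk y)) \in A ->
    rule s A [:: Pos (RDia y b)]
| rule_comp_odia b y : Pos (Inc (odia b) y) \in A ->
    rule s A [:: Pos (RDia y b)]
| rule_neg_obj b C : Neg (OIn b C) \in A ->
    rule s A [:: Neg (Inc b (FCls C))]
| rule_neg_feat y C : Neg (FIn y C) \in A ->
    rule s A [:: Neg (Inc (OCls C) y)]
| rule_app_obj b C : Pos (Inc b (FCls C)) \in A ->
    rule s A [:: Pos (OIn b C)]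
| rule_app_feat y C : Pos (Inc (OCls C) y) \in A ->
    rule s A [:: Pos (FIn y C)]
| rule_SA b y : s = SA b -> Pos (RBox (ONam b) y) \in A ->
    rule s A [:: Pos (RDia y (ONam b))]
| rule_SX y b : s = SX y -> Pos (RDia (FNam y) b) \in A ->
    rule s A [:: Pos (RBox b (FNam y))].

Definition applicable (CN ON FN : eqType) (s : separation ON FN)
    (A new : tabox CN ON FN) : Prop :=
  rule s A new /\ has (fun t => t \notin A) new.

(* Sizes count symbols; an individual name or atomic concept name of the
   language is one symbol. *)
Fixpoint csize (CN : Type) (C : concept CN) : nat :=
  match C with
  | Atom _ => 1
  | Meet C1 C2 | Join C1 C2 => (csize C1 + csize C2).+1
  | Dia C1 | Box C1 => (csize C1).+1
  end.

Fixpoint osize (CN ON : Type) (b : oname CN ON) : nat :=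
  match b with
  | ONam _ => 1
  | OCls C => (csize C).+1
  | ODia b1 | OLBox b1 => (osize b1).+1
  end.

Fixpoint fsize (CN FN : Type) (y : fname CN FN) : nat :=
  match y with
  | FNam _ => 1
  | FCls C => (csize C).+1
  | FBox y1 | FBlk y1 => (fsize y1).+1
  end.

Definition tsize (CN ON FN : Type)
    (t : assertion CN (oname CN ON) (fname CN FN)) : nat :=
  (match body t with
   | RBox b y | RDia y b | Inc b y => osize b + fsize y
   | OIn b C => osize b + csize C
   | FIn y C => fsize y + csize C
   end).+2.

Definition asize (CN ON FN : Type) (A : tabox CN ON FN) : nat :=
  sumn [seq tsize t | t <- A].

(* A timed value carries the number of elementary operations spent on it:
   comparing two expressions costs the sum of their sizes, writing an
   expression costs its size, and visiting an element of a list costs 1. *)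
Definition timed (T : Type) : Type := (T * nat)%type.

Definition ret (T : Type) (x : T) : timed T := (x, 0).

Definition bind (T U : Type) (m : timed T) (f : T -> timed U) : timed U :=
  ((f m.1).1, m.2 + (f m.1).2).

Definition compare (T : eqType) (sz : T -> nat) (x y : T) : timed bool :=
  (x == y, sz x + sz y).

Fixpoint search_has (T : Type) (p : T -> timed bool) (r : seq T) : timed bool :=
  if r is x :: r' then
    bind (p x) (fun ok : bool =>
      if ok then (true, 1) else bind (search_has p r') (fun v => (v, 1)))
  else ret false.

Definition search_mem (T : eqType) (sz : T -> nat) (x : T) : seq T -> timed bool :=
  search_has (compare sz x).

Fixpoint collect (T U : Type) (f : T -> timed (seq U)) (r : seq T) : timed (seq U) :=
  if r is x :: r' then
    bind (f x) (fun u => bind (collect f r') (fun v => (u ++ v, (size u).+1)))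
  else ret [::].

Section Program.
Variables (CN ON FN : eqType) (s : separation ON FN).
Local Notation assert := (assertion CN (oname CN ON) (fname CN FN)).
Local Notation taboxes := (seq (tabox CN ON FN)).

Definition emit (new : tabox CN ON FN) : timed taboxes := ([:: new], asize new).

Definition guard (ok : timed bool) (new : tabox CN ON FN) : timed taboxes :=
  bind ok (fun v : bool => if v then emit new else ret [::]).

Definition both (m1 m2 : timed taboxes) : timed taboxes :=
  bind m1 (fun u => bind m2 (fun v => (u ++ v, (size u).+1))).

Definition odia_inv (b : oname CN ON) : option (oname CN ON) :=
  match b with
  | OCls (Dia C) => Some (OCls C)
  | ODia (OCls _) => None
  | ODia b1 => Some b1
  | _ => None
  end.

Definition fbox_inv (y : fname CN FN) : option (fname CN FN) :=
  match y with
  | FCls (Box C) => Some (FCls C)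
  | FBox (FCls _) => None
  | FBox y1 => Some y1
  | _ => None
  end.

Definition obj_instances (b : oname CN ON) (y : fname CN FN) : timed taboxes :=
  both (if odia_inv b is Some b1 then emit [:: Pos (RDia y b1)] else ret [::])
    match b with
    | OLBox b1 => emit [:: Pos (RBox b1 y)]
    | OCls C => emit [:: Pos (FIn y C)]
    | _ => ret [::]
    end.

Definition feat_instances (b : oname CN ON) (y : fname CN FN) : timed taboxes :=
  both (if fbox_inv y is Some y1 then emit [:: Pos (RBox b y1)] else ret [::])
    match y with
    | FBlk y1 => emit [:: Pos (RDia y1 b)]
    | FCls C => emit [:: Pos (OIn b C)]
    | _ => ret [::]
    end.

Definition instances1 (t : assert) : timed taboxes :=
  match t with
  | Pos (OIn b (Meet C1 C2)) => emit [:: Pos (OIn b C1); Pos (OIn b C2)]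
  | Pos (FIn y (Join C1 C2)) => emit [:: Pos (FIn y C1); Pos (FIn y C2)]
  | Pos (RBox b y) =>
      both (emit [:: Pos (Inc (OLBox b) y); Pos (Inc b (fbox y))])
        (if s is SA b0 then
           guard (compare (@osize CN ON) b (ONam b0)) [:: Pos (RDia y b)]
         else ret [::])
  | Pos (RDia y b) =>
      both (emit [:: Pos (Inc (odia b) y); Pos (Inc b (FBlk y))])
        (if s is SX y0 then
           guard (compare (@fsize CN FN) y (FNam y0)) [:: Pos (RBox b y)]
         else ret [::])
  | Pos (Inc b y) => both (obj_instances b y) (feat_instances b y)
  | Neg (OIn b C) => emit [:: Neg (Inc b (FCls C))]
  | Neg (FIn y C) => emit [:: Neg (Inc (OCls C) y)]
  | _ => ret [::]
  end.

(* cs lists the concepts occurring in the current ABox. *)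
Definition instances2 (cs : seq (concept CN)) (t u : assert) : timed taboxes :=
  match t, u with
  | Pos (OIn b C), Pos (FIn y D) =>
      both (guard (compare (@csize CN) C D) [:: Pos (Inc b y)])
        (both
          (if C is Box C1 then
             guard (compare (@csize CN) C1 D) [:: Pos (RBox b y)]
           else ret [::])
          (if D is Dia D1 then
             guard (compare (@csize CN) C D1) [:: Pos (RDia y b)]
           else ret [::]))
  | Pos (OIn b C1), Pos (OIn b' C2) =>
      bind (compare (@osize CN ON) b b') (fun same : bool =>
        if same then
          guard (search_mem (@csize CN) (Meet C1 C2) cs) [:: Pos (OIn b (Meet C1 C2))]
        else ret [::])
  | Pos (FIn y C1), Pos (FIn y' C2) =>
      bind (compare (@fsize CN FN) y y') (fun same : bool =>
        if same then
          guard (search_mem (@csize CN) (Join C1 C2) cs) [:: Pos (FIn y (Join C1 C2))]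
        else ret [::])
  | _, _ => ret [::]
  end.

Definition list_concepts (A : tabox CN ON FN) : timed (seq (concept CN)) :=
  (concepts A, asize A).

Definition instances (A : tabox CN ON FN) : timed taboxes :=
  bind (list_concepts A) (fun cs =>
    both (collect (fun C => emit [:: Pos (OIn (OCls C) C); Pos (FIn (FCls C) C)]) cs)
      (both (collect instances1 A)
            (collect (fun t => collect (instances2 cs t) A) A))).

Definition is_new (A new : tabox CN ON FN) : timed bool :=
  search_has (fun t => bind (search_mem (@tsize CN ON FN) t A)
                            (fun v => ret (~~ v))) new.

Definition find_applicable (A : tabox CN ON FN) : timed taboxes :=
  bind (instances A) (collect (fun new => bind (is_new A new) (fun v : bool =>
    ret (if v then [:: new] else [::])))).

Definition find_clash (A : tabox CN ON FN) : timed bool :=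
  search_has (fun t => match t with
    | Neg u => if relational u then search_mem (@tsize CN ON FN) (Pos u) A
               else ret false
    | Pos _ => ret false
    end) A.

(* One round of the algorithm on A: look for a clash, list the applicable
   instances of the rules, and add the conclusions of one of them (these have
   been written by find_applicable). *)
Definition round_time (A : tabox CN ON FN) : nat :=
  ((find_clash A).2 + (find_applicable A).2).+1.

End Program.

Section ProgramCorrectness.
Variables (CN ON FN : eqType) (s : separation ON FN).
Implicit Types (A new : tabox CN ON FN).

Lemma search_hasE (T : Type) (p : T -> timed bool) r :
  (search_has p r).1 = has (fun x => (p x).1) r.
Proof. by elim: r => //= x r <-; case: (p x) => [[] n]. Qed.

Lemma search_memE (T : eqType) (sz : T -> nat) x r :
  (search_mem sz x r).1 = (x \in r).
Proof. by rewrite search_hasE -has_pred1; apply: eq_has => y; rewrite /= eq_sym. Qed.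

Lemma mem_collect (T U : eqType) (f : T -> timed (seq U)) r u :
  reflect (exists2 x, x \in r & u \in (f x).1) (u \in (collect f r).1).
Proof.
elim: r => [|x r IH] /=; first by constructor; case.
rewrite mem_cat; apply: (iffP orP) => [[ux|/IH[z zr uz]]|[z]].
- by exists x; rewrite ?mem_head.
- by exists z; rewrite // in_cons zr orbT.
by rewrite in_cons => /predU1P[->|zr] uz; [left|right; apply/IH; exists z].
Qed.

Lemma mem_both (m1 m2 : timed (seq (tabox CN ON FN))) new :
  (new \in (both m1 m2).1) = (new \in m1.1) || (new \in m2.1).
Proof. by rewrite /= mem_cat. Qed.

Lemma mem_guard ok (n new : tabox CN ON FN) :
  (new \in (guard ok n).1) = ok.1 && (new == n).
Proof. by case: ok => [[] k]; rewrite /= ?inE. Qed.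

Lemma find_clashP A : reflect (clash A) (find_clash A).1.
Proof.
rewrite search_hasE; apply: (iffP hasP) => [[[u|u] uA] //=|[t [rt pt nt]]].
  by case: ifP => // ru; rewrite search_memE => pu; exists u.
by exists (Neg t) => //=; rewrite rt search_memE.
Qed.

Lemma odia_invP (b b1 : oname CN ON) : odia_inv b = Some b1 <-> b = odia b1.
Proof.
split; last by move->; case: b1.
by case: b => [a|[]|[]|] //= => [C [<-]|a [<-]|b [<-]|b [<-]].
Qed.

Lemma fbox_invP (y y1 : fname CN FN) : fbox_inv y = Some y1 <-> y = fbox y1.
Proof.
split; last by move->; case: y1.
by case: y => [a|[]|[]|] //= => [C [<-]|a [<-]|b [<-]|b [<-]].
Qed.

Lemma mem_instances A new : new \in (instances s A).1 <-> rule s A new.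
Proof.
rewrite /instances.
change (new \in (both (collect (fun C => emit
  [:: Pos (OIn (OCls C) C); Pos (FIn (FCls C) C)]) (concepts A))
  (both (collect (instances1 s) A)
     (collect (fun t => collect (instances2 (concepts A) t) A) A))).1
  <-> rule s A new).
rewrite !mem_both; split=> [/or3P[]|].
- by move=> /mem_collect[C CA]; rewrite inE => /eqP->; constructor.
- move=> /mem_collect[t tA].
  case: t tA => [] [b y|y b|b y|b C|y C] tA; rewrite /instances1 ?mem_both //.
  + rewrite inE => /predU1P[->|]; first exact: rule_adj_box.
    case E: s => [b0|//]; rewrite mem_guard => /andP[/eqP eb /eqP->].
    by rewrite eb in tA *; apply: rule_SA tA.
  + rewrite inE => /predU1P[->|]; first exact: rule_adj_dia.
    case E: s => [//|y0]; rewrite mem_guard => /andP[/eqP ey /eqP->].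
    by rewrite ey in tA *; apply: rule_SX tA.
  + rewrite /obj_instances /feat_instances ?mem_both.
    case/orP=> /orP[].
    * case E: odia_inv => [b1|//]; rewrite inE => /eqP->.
      by move/odia_invP: E tA => ->; apply: rule_comp_odia.
    * by case: b tA => // [C|b1] tA; rewrite inE => /eqP->;
        [apply: rule_app_feat|apply: rule_comp_lbox].
    * case E: fbox_inv => [y1|//]; rewrite inE => /eqP->.
      by move/fbox_invP: E tA => ->; apply: rule_comp_fbox.
    * by case: y tA => // [C|y1] tA; rewrite inE => /eqP->;
        [apply: rule_app_obj|apply: rule_comp_blk].
  + by case: C tA => // C1 C2 tA; rewrite inE => /eqP->; apply: rule_meet.
  + by case: C tA => // C1 C2 tA; rewrite inE => /eqP->; apply: rule_join.
  + by rewrite inE => /eqP->; apply: rule_neg_obj.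
  + by rewrite inE => /eqP->; apply: rule_neg_feat.
- move=> /mem_collect[t tA] /mem_collect[u uA].
  case: t tA => [] // [] // b C tA; case: u uA => [] // [] // y D uA.
  + rewrite /=; case: eqP => //= eb; rewrite -/(guard _ _) mem_guard search_memE.
    by case/andP=> CD /eqP->; apply: rule_meet_inv => //; rewrite eb.
  + rewrite /instances2 !mem_both mem_guard => /or3P[/andP[/eqP/= e /eqP->]| |].
    * by apply: (@rule_basic _ _ _ _ _ _ _ C) => //; rewrite e.
    * case: C tA => // C tA; rewrite mem_guard => /andP[/eqP/= e /eqP->].
      by apply: (@rule_box _ _ _ _ _ _ _ C) => //; rewrite e.
    * case: D uA => // D uA; rewrite mem_guard => /andP[/eqP/= e /eqP->].
      by apply: (@rule_dia _ _ _ _ _ _ _ D) => //; rewrite -e.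
  + rewrite /=; case: eqP => //= ey; rewrite -/(guard _ _) mem_guard search_memE.
    by case/andP=> CD /eqP->; apply: rule_join_inv => //; rewrite ey.
have one t : t \in A -> new \in (instances1 s t).1 ->
    [|| new \in (collect (fun C => emit
      [:: Pos (OIn (OCls C) C); Pos (FIn (FCls C) C)]) (concepts A)).1,
      new \in (collect (instances1 s) A).1
    | new \in (collect (fun t => collect (instances2 (concepts A) t) A) A).1].
  by move=> tA h; apply/or3P/Or32/mem_collect; exists t.
have two t u : t \in A -> u \in A -> new \in (instances2 (concepts A) t u).1 ->
    [|| new \in (collect (fun C => emit
      [:: Pos (OIn (OCls C) C); Pos (FIn (FCls C) C)]) (concepts A)).1,
      new \in (collect (instances1 s) A).1
    | new \in (collect (fun t => collect (instances2 (concepts A) t) A) A).1].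
  by move=> tA uA h; apply/or3P/Or33/mem_collect; exists t => //; apply/mem_collect; exists u.
move=> h; case: h one two => {new} /=.
- move=> C CA _ _; apply/or3P/Or31/mem_collect; exists C => //=; exact: mem_head.
- move=> b y C bA yA _; apply; [exact: bA|exact: yA|].
  by rewrite /instances2 !mem_both mem_guard /= !eqxx.
- by move=> b C1 C2 h + _; apply; [exact: h|exact: mem_head].
- by move=> b C1 C2 h + _; apply; [exact: h|exact: mem_head].
- move=> b C1 C2 h1 h2 hc _; apply; [exact: h1|exact: h2|].
  by rewrite /= eqxx -/(guard _ _) mem_guard search_memE hc eqxx.
- move=> b C1 C2 h1 h2 hc _; apply; [exact: h1|exact: h2|].
  by rewrite /= eqxx -/(guard _ _) mem_guard search_memE hc eqxx.
- move=> b y C bA yA _; apply; [exact: bA|exact: yA|].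
  by rewrite /instances2 !mem_both !mem_guard /= !eqxx orbT.
- move=> b y C yA bA _; apply; [exact: bA|exact: yA|].
  by rewrite /instances2 !mem_both !mem_guard /= !eqxx ?orbT.
- by move=> b y h + _; apply; [exact: h|rewrite /instances1 mem_both /= ?mem_cat !inE !eqxx].
- by move=> b y h + _; apply; [exact: h|rewrite /instances1 mem_both /= ?mem_cat !inE !eqxx].
- move=> b y h + _; apply; [exact: h|].
  rewrite /instances1 /obj_instances /feat_instances !mem_both.
  by have/fbox_invP-> := erefl (fbox y); rewrite /= ?mem_cat !inE !eqxx ?orbT.
- move=> b y h + _; apply; [exact: h|].
  by rewrite /instances1 /obj_instances /feat_instances !mem_both /= ?mem_cat !inE !eqxx ?orbT.
- move=> b y h + _; apply; [exact: h|].
  by rewrite /instances1 /obj_instances /feat_instances !mem_both /= ?mem_cat !inE !eqxx ?orbT.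
- move=> b y h + _; apply; [exact: h|].
  rewrite /instances1 /obj_instances /feat_instances !mem_both.
  by have/odia_invP-> := erefl (odia b); rewrite /= !inE !eqxx.
- by move=> b C h + _; apply; [exact: h|exact: mem_head].
- by move=> b C h + _; apply; [exact: h|exact: mem_head].
- move=> b C h + _; apply; [exact: h|].
  by rewrite /instances1 /obj_instances /feat_instances !mem_both /= ?mem_cat !inE !eqxx ?orbT.
- move=> b C h + _; apply; [exact: h|].
  by rewrite /instances1 /obj_instances /feat_instances !mem_both /= ?mem_cat !inE !eqxx ?orbT.
- move=> b y -> h + _; apply; [exact: h|].
  by rewrite /instances1 mem_both mem_guard /= !eqxx ?orbT.
- move=> b y -> h + _; apply; [exact: h|].
  by rewrite /instances1 mem_both mem_guard /= !eqxx ?orbT.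
Qed.

Lemma find_applicableP A new :
  new \in (find_applicable s A).1 <-> applicable s A new.
Proof.
have newE n : (is_new A n).1 = has (fun t => t \notin A) n.
  by rewrite search_hasE; apply: eq_has => t; rewrite /= search_memE.
rewrite /find_applicable; split=> [/mem_collect[n /mem_instances rn]|[rn nn]].
  by rewrite /= newE; case: ifP => // nn; rewrite inE => /eqP->.
by apply/mem_collect; exists new; [apply/mem_instances|rewrite /= newE nn mem_head].
Qed.

End ProgramCorrectness.

(* [reaches s A B t]: starting from A, the algorithm may arrive at B after time
   t; the choice of the applicable instance is arbitrary in each round. *)
Inductive reaches (CN ON FN : eqType) (s : separation ON FN)
    (A : tabox CN ON FN) : tabox CN ON FN -> nat -> Prop :=
| reaches_start : reaches s A A 0
| reaches_round B t new :
    reaches s A B t -> ~ clash B -> applicable s B new ->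
    reaches s A (new ++ B) (t + round_time s B).

Definition halted (CN ON FN : eqType) (s : separation ON FN)
    (B : tabox CN ON FN) : Prop :=
  clash B \/ forall new, ~ applicable s B new.

Definition abox_size (CN ON FN : Type) (A : abox CN ON FN) : nat :=
  asize (embed A).

(* The tableau algorithm with the rule s, started on A, always stops within
   time T (the last round included) and reports a clash exactly when A together
   with the formula of s has no model. *)
Definition decides_within (CN ON FN : eqType) (s : separation ON FN)
    (A : abox CN ON FN) (T : nat) : Prop :=
  [/\ forall B t, reaches s (embed A) B t -> t + round_time s B <= T,
      exists B t, reaches s (embed A) B t /\ halted s B &
      forall B t, reaches s (embed A) B t -> halted s B ->
        (clash B <-> ~ consistent A s)].

(* Main.v *)
(* A clash refutes consistency because every rule is sound in any lattice with
   operators Box and Dia that have adjoints, when names are read as elements of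
   the lattice; the concept lattice of a model is such an algebra.  Conversely, a
   saturated clash-free ABox B is its own model: the objects and features are all
   the names, and the three relations are membership in B.

   The same soundness argument, in other algebras, bounds the tableau.  In a
   chain of six elements a name whose operators do not follow the pattern
   [e'] Dia^i L^j [e] (one optional operator at each end, which accounts for the
   rules SA and SX) evaluates to the top, so it is below no feature; in the chain
   of integers with Box = pred and Dia = succ, the depth of the names is bounded.
   A Kripke frame on modal words shows that a concept created by the adjunction
   rules is a concept of the input preceded by a word read on one of the branches
   of the input concepts.  So only polynomially many assertions can occur, and
   each round adds a new one. *)

From Stdlib Require Import ZArith Lia.
From mathcomp Require Import all_boot zify.
From mathcomp Require Import boolp classical_sets.
Require Import Defs.

Set Implicit Arguments.
Unset Strict Implicit.
Unset Printing Implicit Defensive.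

(** * Algebraic semantics of the rules *)

(** A preorder with binary meets and joins is the common core of concept lattices, chains of numbers
    and predicates on a Kripke frame. The behaviour of the operators is encoded by the two
    adjunctions alone, and monotonicity follows from them. *)
Record modal_algebra : Type := ModalAlgebra {
  carrier :> Type;
  mle : carrier -> carrier -> Prop;
  mmeet : carrier -> carrier -> carrier;
  mjoin : carrier -> carrier -> carrier;
  mbox : carrier -> carrier;
  mdia : carrier -> carrier;
  mlbox : carrier -> carrier;
  mblk : carrier -> carrier;
  mle_refl : forall x, mle x x;
  mle_trans : forall y x z, mle x y -> mle y z -> mle x z;
  mle_meet : forall x y z, mle z (mmeet x y) <-> mle z x /\ mle z y;
  mjoin_le : forall x y z, mle (mjoin x y) z <-> mle x z /\ mle y z;
  mlbox_adj : forall x y, mle (mlbox x) y <-> mle x (mbox y);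
  mdia_adj : forall x y, mle (mdia x) y <-> mle x (mblk y)
}.

Section Evaluation.
Variables (CN ON FN : eqType) (L : modal_algebra).
Variables (vo : ON -> L) (vf : FN -> L) (vc : CN -> L).

Fixpoint evC (C : concept CN) : L :=
  match C with
  | Atom D => vc D
  | Meet C1 C2 => mmeet (evC C1) (evC C2)
  | Join C1 C2 => mjoin (evC C1) (evC C2)
  | Dia C1 => mdia (evC C1)
  | Box C1 => mbox (evC C1)
  end.

(** [OCls C] and [FCls C] both receive the value of [C]. Creation then becomes reflexivity, and the
    premise and conclusion of an appending rule become the same inequality. *)
Fixpoint evO (b : oname CN ON) : L :=
  match b with
  | ONam a => vo a
  | OCls C => evC C
  | ODia b1 => mdia (evO b1)
  | OLBox b1 => mlbox (evO b1)
  end.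

Fixpoint evF (y : fname CN FN) : L :=
  match y with
  | FNam x => vf x
  | FCls C => evC C
  | FBox y1 => mbox (evF y1)
  | FBlk y1 => mblk (evF y1)
  end.

Definition holds (t : term CN (oname CN ON) (fname CN FN)) : Prop :=
  match t with
  | RBox b y => mle (evO b) (mbox (evF y))
  | RDia y b => mle (mdia (evO b)) (evF y)
  | Inc b y => mle (evO b) (evF y)
  | OIn b C => mle (evO b) (evC C)
  | FIn y C => mle (evC C) (evF y)
  end.

Definition holds_separation (s : separation ON FN) : Prop :=
  match s with
  | SA b => forall p, mle (vo b) (mbox p) -> mle (mdia (vo b)) p
  | SX y => forall p, mle (mdia p) (vf y) -> mle p (mbox (vf y))
  end.

Lemma evO_odia b : evO (odia b) = mdia (evO b).
Proof. by case: b. Qed.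

Lemma evF_fbox y : evF (fbox y) = mbox (evF y).
Proof. by case: y. Qed.

Variable s : separation ON FN.
Hypothesis sepP : holds_separation s.

(** Read as inequalities, the rules are reflexivity, transitivity, the laws of meets and joins, and
    the two adjunctions; [SA] and [SX] are instances of [sepP]. Negative premises give only negative
    conclusions, so positive assertions can be treated alone. *)
Lemma rule_sound (B new : tabox CN ON FN) :
  (forall t, Pos t \in B -> holds t) -> rule s B new ->
  forall t, Pos t \in new -> holds t.
Proof.
move=> hB r; case: r.
- by move=> C _ t; rewrite !inE => /orP[] /eqP[->] /=; apply: mle_refl.
- move=> b y C /hB/= h1 /hB/= h2 t; rewrite inE => /eqP[->] /=.
  exact: mle_trans h1 h2.
- by move=> b C1 C2 /hB/= /mle_meet[h1 h2] t; rewrite !inE => /orP[] /eqP[->].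
- by move=> b C1 C2 /hB/= /mjoin_le[h1 h2] t; rewrite !inE => /orP[] /eqP[->].
- move=> b C1 C2 /hB/= h1 /hB/= h2 _ t; rewrite inE => /eqP[->] /=.
  by apply/mle_meet.
- move=> b C1 C2 /hB/= h1 /hB/= h2 _ t; rewrite inE => /eqP[->] /=.
  by apply/mjoin_le.
(* Monotonicity of [mbox] is avoided by transposing: the left adjoint applied to [b] lies below [C],
   hence below [y]. *)
- move=> b y C /hB/= /mlbox_adj h1 /hB/= h2 t; rewrite inE => /eqP[->] /=.
  by apply/mlbox_adj; apply: mle_trans h1 h2.
- move=> b y C /hB/= /mdia_adj h1 /hB/= h2 t; rewrite inE => /eqP[->] /=.
  by apply/mdia_adj; apply: mle_trans h2 h1.
- move=> b y /hB/= h t; rewrite !inE => /orP[] /eqP[->] /=; last by rewrite evF_fbox.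
  exact/mlbox_adj.
- move=> b y /hB/= h t; rewrite !inE => /orP[] /eqP[->] /=; first by rewrite evO_odia.
  exact/mdia_adj.
- by move=> b y /hB/=; rewrite evF_fbox => h t; rewrite inE => /eqP[->].
- by move=> b y /hB/= /mlbox_adj h t; rewrite inE => /eqP[->].
- by move=> b y /hB/= /mdia_adj h t; rewrite inE => /eqP[->].
- by move=> b y /hB/=; rewrite evO_odia => h t; rewrite inE => /eqP[->].
- by move=> b C _ t; rewrite inE.
- by move=> b C _ t; rewrite inE.
- by move=> b C /hB h t; rewrite inE => /eqP[->].
- by move=> b C /hB h t; rewrite inE => /eqP[->].
- move=> b y e /hB/= h t; rewrite inE => /eqP[->] /=.
  by move: sepP; rewrite e; apply.
- move=> b y e /hB/= h t; rewrite inE => /eqP[->] /=.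
  by move: sepP; rewrite e; apply.
Qed.


Lemma reaches_sound (A B : tabox CN ON FN) n :
  (forall t, Pos t \in A -> holds t) -> reaches s A B n ->
  forall t, Pos t \in B -> holds t.
Proof.
move=> hA; elim=> {B n} // B n new _ IH _ [r _] t.
by rewrite mem_cat => /orP[|/IH //]; apply: rule_sound r t.
Qed.

End Evaluation.

Lemma rule_neg_origin (CN ON FN : eqType) (s : separation ON FN)
    (B new : tabox CN ON FN) t :
  rule s B new -> Neg t \in new ->
  (exists b C, t = Inc b (FCls C) /\ Neg (OIn b C) \in B) \/
  (exists y C, t = Inc (OCls C) y /\ Neg (FIn y C) \in B).
Proof.
case; try by move=> *; match goal with H : is_true (_ \in _ :: _) |- _ => move: H end; rewrite !inE.
- by move=> b C h; rewrite inE => /eqP[->]; left; exists b, C.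
- by move=> b C h; rewrite inE => /eqP[->]; right; exists b, C.
Qed.

Lemma reaches_sub (CN ON FN : eqType) (s : separation ON FN)
    (A B : tabox CN ON FN) n : reaches s A B n -> {subset A <= B}.
Proof. by elim=> // {}B m new _ IH _ _ t /IH tB; rewrite mem_cat tB orbT. Qed.

Lemma mem_embed_pos (CN ON FN : eqType) (A : abox CN ON FN) t :
  Pos t \in embed A -> exists2 u, Pos u \in A & t = embed_term u.
Proof. by case/mapP=> [[u|u] uA] // [->]; exists u. Qed.

Lemma mem_embed_neg (CN ON FN : eqType) (A : abox CN ON FN) t :
  Neg t \in embed A -> exists2 u, Neg u \in A & t = embed_term u.
Proof. by case/mapP=> [[u|u] uA] // [->]; exists u. Qed.

(** * A clash refutes consistency *)

Section ConceptLattice.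
Variable P : enriched_context.
Local Notation I := (@inc P).
Implicit Types (c d : formal_concept P).
Local Open Scope classical_set_scope.

Definition fc_le c d : Prop := extent c `<=` extent d.

Lemma fc_le_intent c d : fc_le c d <-> intent d `<=` intent c.
Proof.
split=> h; first by rewrite -(extentK c) => x dx a /h; rewrite -(intentK d); apply.
by rewrite /fc_le -(intentK d) => a ca x /h; rewrite -(extentK c); apply.
Qed.

(** I-compatibility speaks of singletons; the set obtained from [B] is the intersection of those
    obtained from its elements, and stable sets are closed under intersection. This supplies the
    intent of the left adjoint of Box. *)
Lemma rbox1_stable_set B : stable_feat I (rel1 (@rbox P) B).
Proof.
apply/seteqP; split; last exact: sub_rel10.
move=> x h a Ba; suff: rel1 (@rbox P) [set a] x by apply.
rewrite -rbox1_stable => b hb; apply: h => y hy; apply: hb => _ ->; exact: hy.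
Qed.

Lemma rdia1_stable_set Y : stable_obj I (rel1 (@rdia P) Y).
Proof.
apply/seteqP; split; last exact: sub_rel01.
move=> a h x Yx; suff: rel1 (@rdia P) [set x] a by apply.
rewrite -rdia1_stable => y hy; apply: h => b hb; apply: hy => _ ->; exact: hb.
Qed.

Definition fc_lbox c : formal_concept P :=
  FormalConcept (rbox1_stable_set (extent c)) erefl.
Definition fc_blk c : formal_concept P :=
  FormalConcept erefl (rdia1_stable_set (intent c)).

Definition fc_algebra : modal_algebra.
Proof.
apply: (@ModalAlgebra (formal_concept P) fc_le (@fc_meet P) (@fc_join P)
          (@fc_box P) (@fc_dia P) fc_lbox fc_blk).
- by move=> x a.
- by move=> y x z h1 h2 a /h1/h2.
- move=> x y z; split=> [h|[h1 h2] a za]; first by split=> a /h [].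
  by split; [apply: h1|apply: h2].
- move=> x y z; rewrite !fc_le_intent; split=> [h|[h1 h2] a za].
    by split=> a /h [].
  by split; [apply: h1|apply: h2].
- move=> x y; rewrite fc_le_intent; split=> [h a xa f yf|h f yf a xa].
    exact: (h f yf a xa).
  exact: (h a xa f yf).
- move=> x y; rewrite fc_le_intent; split=> [h a xa f yf|h f yf a xa].
    exact: (h f yf a xa).
  exact: (h a xa f yf).
Defined.

(** The least concept with [a] in its extent; dually, [fc_feat x] is the greatest concept with [x]
    in its intent. *)
Definition fc_obj (a : obj P) : formal_concept P :=
  @FormalConcept P (rel0 I (rel1 I [set a])) (rel1 I [set a])
    (rel1_rel01 _) erefl.
Definition fc_feat (x : feat P) : formal_concept P :=
  @FormalConcept P (rel0 I [set x]) (rel1 I (rel0 I [set x]))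
    erefl (rel0_rel10 _).

Lemma fc_obj_le a c : fc_le (fc_obj a) c <-> extent c a.
Proof.
split=> [|h]; first by apply; apply: sub_rel01.
by apply/fc_le_intent; rewrite -(extentK c) => x xc _ ->; apply: xc.
Qed.

Lemma fc_le_feat c x : fc_le c (fc_feat x) <-> intent c x.
Proof.
split=> [/fc_le_intent|h]; first by apply; apply: sub_rel10.
by rewrite /fc_le -(intentK c) => a ac _ ->; apply: ac.
Qed.

(** The intent of [fc_feat x] is the closure of [x]. By I-compatibility the features related to [a]
    form a stable set, which contains this closure as soon as it contains [x]. *)
Lemma fc_obj_le_box a x : extent (fc_box (fc_feat x)) a <-> rbox a x.
Proof.
split=> [|h y hy]; first by apply; apply: sub_rel10.
suff: rel1 (@rbox P) [set a] y by apply.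
by rewrite -rbox1_stable => b hb; apply: hy => _ ->; apply: hb => _ ->.
Qed.

Lemma fc_dia_le_feat a x : intent (fc_dia (fc_obj a)) x <-> rdia x a.
Proof.
split=> [|h b hb]; first by apply; apply: sub_rel01.
suff: rel1 (@rdia P) [set x] b by apply.
by rewrite -rdia1_stable => y hy; apply: hb => _ ->; apply: hy => _ ->.
Qed.

End ConceptLattice.

(** * Evaluation of the names in the concept lattice of a model *)

Section ClashInconsistent.
Variables (CN ON FN : eqType) (M : interpretation CN ON FN).
Let L := fc_algebra (ctx M).
Definition model_obj : ON -> L := fun a => fc_obj (iobj M a).
Definition model_feat : FN -> L := fun x => fc_feat (ifeat M x).
Definition model_atom : CN -> L := @iatom CN ON FN M.

Lemma evC_iconcept C : evC model_atom C = iconcept M C.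
Proof. by elim: C => //= [C -> D ->|C -> D ->|C ->|C ->]. Qed.

Lemma holds_embed t : holds model_obj model_feat model_atom (embed_term t) <-> sat_term M t.
Proof.
case: t => [a x|x a|a x|a C|x C] /=; rewrite ?evC_iconcept.
- exact: iff_trans (fc_obj_le _ _) (fc_obj_le_box _ _).
- exact: iff_trans (fc_le_feat _ _) (fc_dia_le_feat _ _).
- split=> [/fc_obj_le|h]; first by apply.
  by apply/fc_obj_le => _ ->.
- exact: fc_obj_le.
- exact: fc_le_feat.
Qed.

Lemma holds_sat_separation s : sat_separation M s -> holds_separation model_obj model_feat s.
Proof.
case: s => [b|y] /= h p.
- move=> /fc_obj_le hb; apply/fc_le_intent => x px.
  by apply/fc_dia_le_feat; apply: h; apply: hb.
- move=> /fc_le_feat hy a pa; apply/fc_obj_le_box; apply: h; exact: hy.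
Qed.

End ClashInconsistent.

Lemma clash_inconsistent (CN ON FN : eqType) (s : separation ON FN)
    (A : abox CN ON FN) B n :
  reaches s (embed A) B n -> clash B -> ~ consistent A s.
Proof.
move=> r [t [_ tB ntB]] [M [hA /holds_sat_separation hs]].
pose h := holds (@model_obj _ _ _ M) (@model_feat _ _ _ M) (@model_atom _ _ _ M).
have hpos u : Pos u \in embed A -> h u.
  by case/mem_embed_pos=> v /hA hv ->; apply/holds_embed.
have hneg u : Neg u \in B -> ~ h u.
  elim: r u {t tB ntB} => {B n} [u|B n new _ IH _ [r _] u].
    by case/mem_embed_neg=> v /hA hv ->; rewrite /h holds_embed.
  rewrite mem_cat => /orP[nu|/IH //].
  (* Premise and conclusion of a negative rule negate convertible statements, because [FCls C] and
     [OCls C] have the value of [C]. *)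
  by have [[b [C [-> /IH]]]|[y [C [-> /IH]]]] := rule_neg_origin r nu.
exact: hneg ntB (reaches_sound hs hpos r tB).
Qed.

(** * The canonical model of a saturated clash-free ABox *)

Lemma subconcepts_refl (CN : eqType) (C : concept CN) : C \in subconcepts C.
Proof. by case: C => *; rewrite mem_head. Qed.

Lemma subconcepts_trans (CN : eqType) (C D : concept CN) :
  D \in subconcepts C -> {subset subconcepts D <= subconcepts C}.
Proof.
elim: C => [N|C1 IH1 C2 IH2|C1 IH1 C2 IH2|C1 IH1|C1 IH1] /=;
  rewrite in_cons => /predU1P[->|] // h E ED; rewrite in_cons.
- by move: h; rewrite !mem_cat => /orP[/IH1/(_ E ED)|/IH2/(_ E ED)] ->; rewrite ?orbT.
- by move: h; rewrite !mem_cat => /orP[/IH1/(_ E ED)|/IH2/(_ E ED)] ->; rewrite ?orbT.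
- by rewrite (IH1 h E ED) orbT.
- by rewrite (IH1 h E ED) orbT.
Qed.

Lemma concepts_sub (CN ON FN : eqType) (B : tabox CN ON FN) (C D : concept CN) :
  C \in concepts B -> D \in subconcepts C -> D \in concepts B.
Proof.
case/flatten_mapP=> t tB Ct DC; apply/flatten_mapP; exists t => //.
by case: (body t) Ct => //= [_ E|_ E] CE; apply: subconcepts_trans DC.
Qed.

Section CanonicalModel.
Variables (CN ON FN : eqType) (s : separation ON FN) (B : tabox CN ON FN).
Hypothesis saturated : forall new, rule s B new -> {subset new <= B}.
Local Open Scope classical_set_scope.

Let can_inc (b : oname CN ON) (y : fname CN FN) : Prop := Pos (Inc b y) \in B.
Let can_rbox (b : oname CN ON) (y : fname CN FN) : Prop := Pos (RBox b y) \in B.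
Let can_rdia (y : fname CN FN) (b : oname CN ON) : Prop := Pos (RDia y b) \in B.

Let sat1 new t : rule s B new -> t \in new -> t \in B.
Proof. by move=> /saturated; apply. Qed.

(** In a saturated ABox the adjunction and I-compatibility rules are converse to each other. The
    sets required to be stable thus become polars of a generated name, and polars are always
    stable. *)
Lemma can_rbox_fbox b y : can_rbox b y <-> can_inc b (fbox y).
Proof.
split=> [/(rule_adj_box s)/sat1|/(rule_comp_fbox s)/sat1]; apply;
  by rewrite !inE eqxx ?orbT.
Qed.

Lemma can_rbox_lbox b y : can_rbox b y <-> can_inc (OLBox b) y.
Proof.
split=> [/(rule_adj_box s)/sat1|/(rule_comp_lbox s)/sat1]; apply;
  by rewrite !inE eqxx ?orbT.
Qed.

Lemma can_rdia_blk b y : can_rdia y b <-> can_inc b (FBlk y).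
Proof.
split=> [/(rule_adj_dia s)/sat1|/(rule_comp_blk s)/sat1]; apply;
  by rewrite !inE eqxx ?orbT.
Qed.

Lemma can_rdia_odia b y : can_rdia y b <-> can_inc (odia b) y.
Proof.
split=> [/(rule_adj_dia s)/sat1|/(rule_comp_odia s)/sat1]; apply;
  by rewrite !inE eqxx ?orbT.
Qed.

Lemma stable_polar0 (Y : set (fname CN FN)) : stable_obj can_inc (rel0 can_inc Y).
Proof.
by apply/seteqP; split=> [b h y Yy|b h y]; [apply: h => c; apply|apply].
Qed.

Lemma stable_polar1 (Y : set (oname CN ON)) : stable_feat can_inc (rel1 can_inc Y).
Proof.
by apply/seteqP; split=> [b h y Yy|b h y]; [apply: h => c; apply|apply].
Qed.

Lemma can_rbox0_stable y : stable_obj can_inc (rel0 can_rbox [set y]).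
Proof.
suff -> : rel0 can_rbox [set y] = rel0 can_inc [set fbox y] by apply: stable_polar0.
by apply/seteqP; split=> b h _ ->; apply/can_rbox_fbox; apply: h.
Qed.

Lemma can_rbox1_stable b : stable_feat can_inc (rel1 can_rbox [set b]).
Proof.
suff -> : rel1 can_rbox [set b] = rel1 can_inc [set OLBox b] by apply: stable_polar1.
by apply/seteqP; split=> y h _ ->; apply/can_rbox_lbox; apply: h.
Qed.

Lemma can_rdia0_stable b : stable_feat can_inc (rel0 can_rdia [set b]).
Proof.
suff -> : rel0 can_rdia [set b] = rel1 can_inc [set odia b] by apply: stable_polar1.
by apply/seteqP; split=> y h _ ->; apply/can_rdia_odia; apply: h.
Qed.

Lemma can_rdia1_stable y : stable_obj can_inc (rel1 can_rdia [set y]).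
Proof.
suff -> : rel1 can_rdia [set y] = rel0 can_inc [set FBlk y] by apply: stable_polar0.
by apply/seteqP; split=> b h _ ->; apply/can_rdia_blk; apply: h.
Qed.

Definition can_ctx : enriched_context :=
  EnrichedContext can_rbox0_stable can_rbox1_stable can_rdia0_stable can_rdia1_stable.

(** An atom absent from [B] needs a formal concept too, so the extent is the polar of
    [FCls (Atom D)]. For an atom of [concepts B] it agrees with membership in [B]. *)
Definition can_atom (D : CN) : formal_concept can_ctx :=
  @FormalConcept can_ctx (rel0 can_inc [set FCls (Atom D)]) _
    erefl (stable_polar0 [set FCls (Atom D)]).

Definition can_model : interpretation CN ON FN :=
  @Interpretation CN ON FN can_ctx (@ONam CN ON) (@FNam CN FN) can_atom.

Let ext C (b : oname CN ON) : Prop := extent (iconcept can_model C) b.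
Let int C (y : fname CN FN) : Prop := intent (iconcept can_model C) y.

Section Membership.
Variable C : concept CN.
Hypothesis CB : C \in concepts B.

Lemma can_cls_obj : Pos (OIn (OCls C) C) \in B.
Proof. by apply: sat1 (rule_creation s CB) _; rewrite mem_head. Qed.

Lemma can_cls_feat : Pos (FIn (FCls C) C) \in B.
Proof. by apply: sat1 (rule_creation s CB) _; rewrite !inE eqxx orbT. Qed.

Lemma can_obj_in b : Pos (OIn b C) \in B <-> can_inc b (FCls C).
Proof.
split=> h; first by apply: sat1 (rule_basic s h can_cls_feat) (mem_head _ _).
exact: sat1 (rule_app_obj s h) (mem_head _ _).
Qed.

Lemma can_feat_in y : Pos (FIn y C) \in B <-> can_inc (OCls C) y.
Proof.
split=> h; first by apply: sat1 (rule_basic s can_cls_obj h) (mem_head _ _).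
exact: sat1 (rule_app_feat s h) (mem_head _ _).
Qed.

(** The name [OCls C] belongs to the extent, so a feature of the intent is incident with it and the
    appending rule applies; the basic rule gives the converse. It therefore suffices to prove the
    truth lemma on one side. *)
Lemma can_intent_of_extent :
  (forall b, ext C b <-> Pos (OIn b C) \in B) ->
  forall y, int C y <-> Pos (FIn y C) \in B.
Proof.
move=> hC y; rewrite /int -extentK; split=> [h|h b /hC hb].
  by apply/can_feat_in; apply: h; apply/hC/can_cls_obj.
exact: sat1 (rule_basic s hb h) (mem_head _ _).
Qed.

Lemma can_extent_of_intent :
  (forall y, int C y <-> Pos (FIn y C) \in B) ->
  forall b, ext C b <-> Pos (OIn b C) \in B.
Proof.
move=> hC b; rewrite /ext -intentK; split=> [h|h y /hC hy].
  by apply/can_obj_in; apply: h; apply/hC/can_cls_feat.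
exact: sat1 (rule_basic s h hy) (mem_head _ _).
Qed.

End Membership.

(** The truth lemma, by induction on [C]. Each connective is treated on the side where its formal
    concept is defined directly: the extent for atoms, Meet and Box, the intent for Join and Dia. *)
Lemma can_truth C : C \in concepts B ->
  (forall b, ext C b <-> Pos (OIn b C) \in B) /\
  (forall y, int C y <-> Pos (FIn y C) \in B).
Proof.
elim: C => [D|C1 IH1 C2 IH2|C1 IH1 C2 IH2|C1 IH1|C1 IH1] CB.
- suff h b : ext (Atom D) b <-> Pos (OIn b (Atom D)) \in B.
    by split=> //; apply: can_intent_of_extent.
  split=> [h|/(can_obj_in CB) h]; first by apply/(can_obj_in CB); apply: h.
  by move=> _ ->.
- have C1B : C1 \in concepts B.
    by apply: concepts_sub CB _; rewrite /= inE mem_cat subconcepts_refl orbT.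
  have C2B : C2 \in concepts B.
    by apply: concepts_sub CB _; rewrite /= inE mem_cat subconcepts_refl !orbT.
  have [e1 _] := IH1 C1B; have [e2 _] := IH2 C2B.
  suff h b : ext (Meet C1 C2) b <-> Pos (OIn b (Meet C1 C2)) \in B.
    by split=> //; apply: can_intent_of_extent.
  split=> [[/e1 h1 /e2 h2]|h].
    exact: sat1 (rule_meet_inv s h1 h2 CB) (mem_head _ _).
  by split; [apply/e1|apply/e2]; apply: sat1 (rule_meet s h) _;
    rewrite !inE eqxx ?orbT.
- have C1B : C1 \in concepts B.
    by apply: concepts_sub CB _; rewrite /= inE mem_cat subconcepts_refl orbT.
  have C2B : C2 \in concepts B.
    by apply: concepts_sub CB _; rewrite /= inE mem_cat subconcepts_refl !orbT.
  have [_ i1] := IH1 C1B; have [_ i2] := IH2 C2B.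
  suff h y : int (Join C1 C2) y <-> Pos (FIn y (Join C1 C2)) \in B.
    by split=> //; apply: can_extent_of_intent.
  split=> [[/i1 h1 /i2 h2]|h].
    exact: sat1 (rule_join_inv s h1 h2 CB) (mem_head _ _).
  by split; [apply/i1|apply/i2]; apply: sat1 (rule_join s h) _;
    rewrite !inE eqxx ?orbT.
- have C1B : C1 \in concepts B.
    by apply: concepts_sub CB _; rewrite /= inE subconcepts_refl orbT.
  have [e1 i1] := IH1 C1B.
  suff h y : int (Dia C1) y <-> Pos (FIn y (Dia C1)) \in B.
    by split=> //; apply: can_extent_of_intent.
  split=> [h|h b /e1 hb]; last exact: sat1 (rule_dia s h hb) (mem_head _ _).
  (* A single object of the extent suffices, namely [OCls C1]: since [odia] sends it to
     [OCls (Dia C1)], the adjunction and appending rules yield the assertion. *)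
  apply/(can_feat_in CB)/(can_rdia_odia (OCls C1)); apply: h; apply/e1.
  exact: can_cls_obj.
- have C1B : C1 \in concepts B.
    by apply: concepts_sub CB _; rewrite /= inE subconcepts_refl orbT.
  have [e1 i1] := IH1 C1B.
  suff h b : ext (Box C1) b <-> Pos (OIn b (Box C1)) \in B.
    by split=> //; apply: can_intent_of_extent.
  split=> [h|h y /i1 hy]; last exact: sat1 (rule_box s h hy) (mem_head _ _).
  apply/(can_obj_in CB)/(can_rbox_fbox _ (FCls C1)); apply: h; apply/i1.
  exact: can_cls_feat.
Qed.

Lemma can_sat_pos t : Pos (embed_term t) \in B -> sat_term can_model t.
Proof.
case: t => [a x|x a|a x|a C|x C] //= h.
- have CB : C \in concepts B.
    by apply/flatten_mapP; exists (Pos (OIn (ONam a) C)) => //; apply: subconcepts_refl.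
  by have [e _] := can_truth CB; apply/e.
- have CB : C \in concepts B.
    by apply/flatten_mapP; exists (Pos (FIn (FNam x) C)) => //; apply: subconcepts_refl.
  by have [_ e] := can_truth CB; apply/e.
Qed.

Lemma can_sat_neg t : ~ clash B -> Neg (embed_term t) \in B -> ~ sat_term can_model t.
Proof.
move=> nclash; case: t => [a x|x a|a x|a C|x C] //= h hp.
- by apply: nclash; exists (RBox (ONam a) (FNam x)).
- by apply: nclash; exists (RDia (FNam x) (ONam a)).
- by apply: nclash; exists (Inc (ONam a) (FNam x)).
- have CB : C \in concepts B.
    by apply/flatten_mapP; exists (Neg (OIn (ONam a) C)) => //; apply: subconcepts_refl.
  have [e _] := can_truth CB.
  (* Opposite concept assertions are not themselves a clash; the negative and basic rules turn them
     into opposite incidences with [FCls C]. *)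
  apply: nclash; exists (Inc (ONam a) (FCls C)); split=> //.
    by apply/(can_obj_in CB)/e.
  exact: sat1 (rule_neg_obj s h) (mem_head _ _).
- have CB : C \in concepts B.
    by apply/flatten_mapP; exists (Neg (FIn (FNam x) C)) => //; apply: subconcepts_refl.
  have [_ e] := can_truth CB.
  apply: nclash; exists (Inc (OCls C) (FNam x)); split=> //.
    by apply/(can_feat_in CB)/e.
  exact: sat1 (rule_neg_feat s h) (mem_head _ _).
Qed.

(** The points of the canonical model are exactly the names, so the universal quantifier of the
    formula is matched by the rule applied to an arbitrary name. *)
Lemma can_sat_separation : sat_separation can_model s.
Proof.
case E: s => [b|y] p h.
  exact: sat1 (rule_SA E h) (mem_head _ _).
exact: sat1 (rule_SX E h) (mem_head _ _).
Qed.

End CanonicalModel.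

Lemma saturated_consistent (CN ON FN : eqType) (s : separation ON FN)
    (A : abox CN ON FN) B n :
  reaches s (embed A) B n -> ~ clash B -> (forall new, ~ applicable s B new) ->
  consistent A s.
Proof.
move=> r ncl nap.
have sat new : rule s B new -> {subset new <= B}.
  move=> h t tn; apply/negPn/negP => tB; apply: (nap new); split=> //.
  by apply/hasP; exists t.
exists (can_model sat); split; last exact: can_sat_separation.
move=> [t|t] tA /=; [apply: can_sat_pos|apply: can_sat_neg => //];
  apply: (reaches_sub r); apply/mapP; by [exists (Pos t)|exists (Neg t)].
Qed.

(** * Algebras that bound the tableau *)

Definition opposite (L : modal_algebra) : modal_algebra :=
  @ModalAlgebra L (fun x y => mle y x) (@mjoin L) (@mmeet L)
    (@mdia L) (@mbox L) (@mblk L) (@mlbox L) (@mle_refl L)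
    (fun y x z h1 h2 => mle_trans h2 h1)
    (@mjoin_le L) (@mle_meet L)
    (fun x y => iff_sym (mdia_adj y x)) (fun x y => iff_sym (mlbox_adj y x)).

(** Box and Dia use two independent relations. Their adjoints are the diamond along the converse of
    [rb] and the box along the converse of [rd]. *)
Definition kripke_algebra (X : Type) (rb rd : X -> X -> Prop) : modal_algebra.
Proof.
apply: (@ModalAlgebra (X -> Prop) (fun e f => forall p, e p -> f p)
  (fun e f p => e p /\ f p) (fun e f p => e p \/ f p)
  (fun e p => forall q, rb p q -> e q) (fun e p => exists2 q, rd p q & e q)
  (fun e q => exists2 p, rb p q & e p) (fun e q => forall p, rd p q -> e p)).
- by [].
- by move=> y x z h1 h2 p /h1/h2.
- move=> x y z; split=> [h|[h1 h2] p zp]; first by split=> p /h[].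
  by split; [apply: h1|apply: h2].
- move=> x y z; split=> [h|[h1 h2] p []]; [|exact: h1|exact: h2].
  by split=> p hp; apply: h; [left|right].
- move=> x y; split=> [h p xp q pq|h q [p pq xp]]; first by apply: h; exists p.
  exact: h pq.
- move=> x y; split=> [h q xq p pq|h p [q pq xq]]; first by apply: h; exists q.
  exact: h pq.
Defined.

(* The values of names and concepts in this chain are those of a finite
   automaton reading the modal operators of a name: an object name with value 5
   is below no feature name that the tableau can produce. *)
Definition step_box (v : nat) : nat := nth v [:: 0; 0; 2; 2; 3] v.
Definition step_dia (v : nat) : nat := nth v [:: 0; 2; 3; 3; 5] v.
Definition step_lbox (v : nat) : nat := nth v [:: 0; 2; 2; 4; 5] v.
Definition step_blk (v : nat) : nat := nth v [:: 0; 0; 1; 3; 3] v.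

(** The default value of [nth] makes every step the identity from 5 upwards, so all of [nat] can be
    the carrier and the adjunctions are checked on the values 0 to 4 and on the rest. *)
Definition shape_chain : modal_algebra.
Proof.
apply: (@ModalAlgebra nat (fun u v => u <= v) minn maxn
  step_box step_dia step_lbox step_blk).
- by move=> x; apply: leqnn.
- by move=> y x z; apply: leq_trans.
- by move=> x y z; rewrite leq_min; split=> [/andP|] // [-> ->].
- by move=> x y z; rewrite geq_max; split=> [/andP|] // [-> ->].
- by move=> [|[|[|[|[|x]]]]] [|[|[|[|[|y]]]]]; rewrite /step_box /step_lbox /= ?nth_nil.
- by move=> [|[|[|[|[|x]]]]] [|[|[|[|[|y]]]]]; rewrite /step_dia /step_blk /= ?nth_nil.
Defined.

Definition depth_chain : modal_algebra.
Proof.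
apply: (@ModalAlgebra Z Z.le Z.min Z.max Z.pred Z.succ Z.succ Z.pred); lia.
Defined.

(** * Dual concepts and modal words *)

Fixpoint dualC (CN : Type) (C : concept CN) : concept CN :=
  match C with
  | Atom D => Atom D
  | Meet C1 C2 => Join (dualC C1) (dualC C2)
  | Join C1 C2 => Meet (dualC C1) (dualC C2)
  | Dia C1 => Box (dualC C1)
  | Box C1 => Dia (dualC C1)
  end.

Lemma evC_opposite (CN : eqType) (L : modal_algebra) (vc : CN -> L) C :
  @evC CN (opposite L) vc C = evC vc (dualC C).
Proof. by elim: C => //= [C -> D ->|C -> D ->|C ->|C ->]. Qed.

(* The modal words labelling the branches of a concept, true standing for Box. *)
Fixpoint leaves (CN : Type) (C : concept CN) : seq (seq bool) :=
  match C with
  | Atom _ => [:: [::]]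
  | Meet C1 C2 | Join C1 C2 => leaves C1 ++ leaves C2
  | Dia C1 => map (cons false) (leaves C1)
  | Box C1 => map (cons true) (leaves C1)
  end.

Lemma leaves_dual (CN : Type) (C : concept CN) :
  leaves (dualC C) = map (map negb) (leaves C).
Proof.
by elim: C => //= [C -> D ->|C -> D ->|C ->|C ->]; rewrite ?map_cat // -!map_comp.
Qed.

(** * A Kripke frame on modal words *)

Section WordFrame.
Variables (CN : eqType) (cs : seq (concept CN)).
Hypothesis cs_sub : forall C D, C \in cs -> D \in subconcepts C -> D \in cs.

(* Every point has a Box-edge to the empty word and a Dia-edge from None, so
   that whatever lies below a Box is evaluated at the empty word. *)
Definition word_box (p q : option (seq bool)) : Prop :=
  match p, q with
  | Some v, Some w => w = rcons v true \/ w = [::]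
  | None, Some w => w = [::]
  | None, None => True
  | Some _, None => False
  end.
Definition word_dia (p q : option (seq bool)) : Prop :=
  match p, q with
  | Some v, Some w => w = rcons v false
  | None, _ => True
  | Some _, None => False
  end.
Definition word_algebra : modal_algebra := kripke_algebra word_box word_dia.

Definition word_root : word_algebra := fun p => p = None \/ p = Some [::].

Definition leaf_words : seq (seq bool) := flatten [seq leaves C | C <- cs].

Definition word_atom (D : CN) : word_algebra :=
  fun p => if p is Some w then w \in leaf_words else True.

Definition word_true (C : concept CN) : option (seq bool) -> Prop := evC word_atom C.

(** A word is read along the branches of [C], and atoms hold exactly at the words of input branches.
    [word_true_leaf] is a partial converse: truth at a word forces one of the branches to end in a
    leaf word. *)
Lemma word_true_leaves C w : C \in cs ->
  (forall q, q \in leaves C -> w ++ q \in leaf_words) -> word_true C (Some w).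
Proof.
elim: C w => [N|C1 IH1 C2 IH2|C1 IH1 C2 IH2|C1 IH1|C1 IH1] w CB h.
- by move: (h [::]); rewrite cats0; apply; rewrite mem_head.
- have h1 : C1 \in cs.
    by apply: cs_sub CB _; rewrite /= inE mem_cat subconcepts_refl orbT.
  have h2 : C2 \in cs.
    by apply: cs_sub CB _; rewrite /= inE mem_cat subconcepts_refl !orbT.
  split; [apply: IH1 => //|apply: IH2 => //];
    by move=> q hq; apply: h; rewrite mem_cat hq ?orbT.
- have h1 : C1 \in cs.
    by apply: cs_sub CB _; rewrite /= inE mem_cat subconcepts_refl orbT.
  left; apply: IH1 => //; by move=> q hq; apply: h; rewrite mem_cat hq ?orbT.
- have h1 : C1 \in cs.
    by apply: cs_sub CB _; rewrite /= inE subconcepts_refl orbT.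
  exists (Some (rcons w false)) => //; apply: IH1 => // q hq.
  by rewrite cat_rcons; apply/h/map_f.
- have h1 : C1 \in cs.
    by apply: cs_sub CB _; rewrite /= inE subconcepts_refl orbT.
  (* The additional Box-edge leads to the empty word, where the hypothesis holds because [C1] is
     itself in [cs]. *)
  move=> [v|] //= [->|->]; apply: IH1 => // q hq.
    by rewrite cat_rcons; apply/h/map_f.
  by apply/flatten_mapP; exists C1.
Qed.

Lemma word_true_root C : C \in cs -> forall p, word_root p -> word_true C p.
Proof.
have hnil D : D \in cs -> word_true D (Some [::]).
  by move=> h; apply: word_true_leaves => // q hq; apply/flatten_mapP; exists D.
move=> CB _ [->|->]; last exact: hnil.
elim: C CB => [N|C1 IH1 C2 IH2|C1 IH1 C2 IH2|C1 IH1|C1 IH1] CB //.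
- by split; [apply: IH1|apply: IH2]; apply: cs_sub CB _;
    rewrite /= inE mem_cat subconcepts_refl ?orbT.
- by left; apply: IH1; apply: cs_sub CB _;
    rewrite /= inE mem_cat subconcepts_refl ?orbT.
- by exists None => //; apply: IH1; apply: cs_sub CB _;
    rewrite /= inE subconcepts_refl ?orbT.
- have h1 : C1 \in cs by apply: cs_sub CB _; rewrite /= inE subconcepts_refl orbT.
  by move=> [v|] /= h; [rewrite h; apply: hnil|apply: IH1].
Qed.

Lemma word_true_leaf C v : word_true C (Some v) ->
  exists2 q, q \in leaves C & v ++ q \in leaf_words.
Proof.
elim: C v => [N|C1 IH1 C2 IH2|C1 IH1 C2 IH2|C1 IH1|C1 IH1] v /=.
- by move=> h; exists [::]; rewrite ?cats0 ?mem_head.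
- by case=> /IH1[q h1 h2] _; exists q; rewrite // mem_cat h1.
- by case=> [/IH1[q h1 h2]|/IH2[q h1 h2]]; exists q; rewrite // mem_cat h1 ?orbT.
- case=> -[w|] //= -> /IH1[q h1]; rewrite cat_rcons => h2.
  by exists (false :: q) => //; apply: map_f.
- move=> /(_ (Some (rcons v true)) (or_introl erefl)) /IH1[q h1].
  by rewrite cat_rcons => h2; exists (true :: q) => //; apply: map_f.
Qed.

End WordFrame.

(** * The concepts that the adjunction rules can create *)

Section Good.
Variables (CN : eqType) (cs : seq (concept CN)).
Hypothesis cs_sub : forall C D, C \in cs -> D \in subconcepts C -> D \in cs.
Local Notation cs' := (map (@dualC CN) cs).

Lemma dual_cs_sub C D : C \in cs' -> D \in subconcepts C -> D \in cs'.
Proof.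
have h (E : concept CN) : subconcepts (dualC E) = map (@dualC CN) (subconcepts E).
  by elim: E => //= [E -> F ->|E -> F ->|E ->|E ->]; rewrite ?map_cat.
case/mapP=> E ecs ->; rewrite h => /mapP[F FE ->]; apply: map_f.
exact: cs_sub FE.
Qed.

Lemma leaf_words_dual : leaf_words cs' = map (map negb) (leaf_words cs).
Proof.
rewrite /leaf_words map_flatten -!map_comp; congr flatten.
by apply: eq_map => C /=; rewrite leaves_dual.
Qed.

(* The concepts that may occur in the tableau: the rules adj_box and adj_dia
   create Box C and Dia C only when C satisfies the second condition. *)
Inductive good : concept CN -> Prop :=
| good_in C : C \in cs -> good C
| good_box C : good C -> word_true cs C (Some [::]) -> good (Box C)
| good_dia C : good C -> word_true cs' (dualC C) (Some [::]) -> good (Dia C).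

Lemma good_sub C D : good C -> D \in subconcepts C -> good D.
Proof.
move=> g; elim: g D => {C} [C CB|C g IH h|C g IH h] D.
- by move=> DC; apply/good_in/(cs_sub CB).
- by rewrite /= inE => /predU1P[->|/IH //]; apply: good_box.
- by rewrite /= inE => /predU1P[->|/IH //]; apply: good_dia.
Qed.

(** At [None] a Box has to be checked at the empty word, which is the second condition of
    [good_box], and at [None] itself, which is the induction hypothesis. A Dia is witnessed by the
    loop at [None]. *)
Lemma good_none C : good C -> word_true cs C None.
Proof.
elim=> {C} [C CB|C _ IH h|C _ IH h]; first by apply: word_true_root => //; left.
  by move=> [w|] //= ->.
by exists None.
Qed.

Lemma good_none_dual C : good C -> word_true cs' (dualC C) None.
Proof.
elim=> {C} [C CB|C _ IH h|C _ IH h].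
- by apply: word_true_root; [exact: dual_cs_sub|exact: map_f|left].
- by exists None.
- by move=> [w|] //= ->.
Qed.

Definition wrap (w : seq bool) (C : concept CN) : concept CN :=
  foldr (fun c D => if c then Box D else Dia D) C w.

Lemma leaves_wrap w C : leaves (wrap w C) = map (cat w) (leaves C).
Proof.
elim: w => [|[] w IH] /=; first by rewrite map_id.
  by rewrite IH -map_comp.
by rewrite IH -map_comp.
Qed.

Lemma good_wrap C : good C -> exists w D, D \in cs /\ C = wrap w D.
Proof.
elim=> {C} [C CB|C _ [w [D [DB ->]]] _|C _ [w [D [DB ->]]] _].
- by exists [::], C.
- by exists (true :: w), D.
- by exists (false :: w), D.
Qed.

Definition new_words (n : nat) : seq (seq bool) :=
  [seq c :: w | c <- [:: true; false],
                w <- [seq take i q | i <- iota 0 n.+1, q <- leaf_words cs]].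

Definition good_list (n : nat) : seq (concept CN) :=
  cs ++ [seq wrap w C | w <- new_words n, C <- cs].

(** Below its outermost operator, a created concept has the form [wrap w E] with [E] in [cs], and
    one of its branches is a leaf word. Hence [w] is a prefix of a leaf word, which leaves
    polynomially many choices. *)
Lemma good_mem n C : (forall q, q \in leaf_words cs -> size q <= n) ->
  good C -> C \in good_list n.
Proof.
move=> hn.
have key c D : good D -> (exists2 q, q \in leaves D & q \in leaf_words cs) ->
    wrap [:: c] D \in good_list n.
  move=> /good_wrap[w [E [ECS ->]]] [q]; rewrite leaves_wrap => /mapP[r rE ->] h.
  rewrite mem_cat -[wrap _ (wrap w E)]/(wrap (c :: w) E); apply/orP; right.
  apply: allpairs_f => //; apply: allpairs_f; first by case: c; rewrite !inE.
  (* The leaf word at hand is [w ++ r], and [w] is recovered as its prefix of length [size w]. *)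
  rewrite -[w](take_size_cat r (erefl (size w))); apply: allpairs_f => //.
  rewrite mem_iota add0n ltnS; apply: leq_trans (hn _ h); by rewrite size_cat leq_addr.
case=> [D h|D g h|D g h]; first by rewrite mem_cat h.
  by apply: (key true) => //; have [q h1 h2] := word_true_leaf h; exists q.
(* For Dia the leaf word comes from the dual concepts; negating its letters returns to [cs]. *)
apply: (key false) => //; have [q h1 /= h2] := word_true_leaf h.
move: h1 h2; rewrite leaves_dual leaf_words_dual => /mapP[r rD ->].
by rewrite mem_map => [|? ?]; [exists r|apply: inj_map; case=> [] []].
Qed.

Lemma size_good_list n :
  size (good_list n) = size cs + 2 * (n.+1 * size (leaf_words cs)) * size cs.
Proof. by rewrite size_cat !size_allpairs size_iota. Qed.

Lemma csize_wrap w C : csize (wrap w C) = size w + csize C.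
Proof. by elim: w => [|[] w IH] //=; rewrite IH. Qed.

Lemma csize_good n C : (forall q, q \in leaf_words cs -> size q <= n) ->
  (forall D, D \in cs -> csize D <= n) -> good C -> csize C <= 2 * n + 1.
Proof.
move=> hq hn /(good_mem hq); rewrite mem_cat => /orP[/hn|]; first by lia.
case/allpairsP=> p [/allpairsP[u [_ hv ->]] /hn hD ->]; rewrite csize_wrap /=.
case/allpairsP: hv => r [_ /hq qn ->].
(* One new letter and a prefix of a leaf word give at most [n.+1] operators, in front of a concept
   of size at most [n]. *)
apply: (@leq_trans (n.+1 + n)); last by lia.
apply: leq_add hD; rewrite ltnS size_take_min; exact: leq_trans (geq_minr _ _) qn.
Qed.

End Good.

(** * The names that occur in the tableau *)

Definition step (c : bool) (v : nat) : nat := if c then step_lbox v else step_dia v.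
Definition run (w : seq bool) (v : nat) : nat := foldr step v w.

Definition letters : seq (seq bool) := [:: [::]; [:: true]; [:: false]].

Definition shapes (N : nat) : seq (seq bool) :=
  [seq u ++ v | u <- [seq e ++ nseq i false | e <- letters, i <- iota 0 N.+1],
                v <- [seq nseq j true ++ e | j <- iota 0 N.+1, e <- letters]].

Lemma size_shapes N : size (shapes N) = (3 * N.+1) * (N.+1 * 3).
Proof. by rewrite !size_allpairs !size_iota. Qed.

Lemma run_ge1 w v : 0 < v -> 0 < run w v.
Proof.
move=> hv; elim: w => //= c w; move: (run w v) => r.
by case: c; move: r => [|[|[|[|[|r]]]]]; rewrite /step /step_lbox /step_dia /= ?nth_nil.
Qed.

(** [step] is an automaton reading the operators of a name from the inside out. Value 1 allows no
    operator, 2 a first operator followed by left adjoints of Box, 3 then a block of Dia, 4 one last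
    operator; at 5 the word is rejected. A larger initial value only restricts the words further. *)
Lemma run_decomposition w v : 0 < v ->
  [/\ run w v <= 1 -> w = [::],
      run w v <= 2 -> exists j e, e \in letters /\ w = nseq j true ++ e,
      run w v <= 3 ->
        exists i j e, e \in letters /\ w = nseq i false ++ nseq j true ++ e &
      run w v <= 4 -> exists e' i j e, [/\ e' \in letters, e \in letters &
        w = e' ++ nseq i false ++ nseq j true ++ e]].
Proof.
move=> hv; elim: w => [|c w [IH1 IH2 IH3 IH4]].
  split=> // _; first by exists 0, [::].
    by exists 0, 0, [::].
  by exists [::], 0, 0, [::].
have h1 : run (c :: w) v <= 1 -> c :: w = [::].
  have := run_ge1 w hv => /=; move: (run w v) => r.
  by case: c; move: r => [|[|[|[|[|r]]]]]; rewrite /step /step_lbox /step_dia /= ?nth_nil.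
have h2 : run (c :: w) v <= 2 -> exists j e, e \in letters /\ c :: w = nseq j true ++ e.
  have := run_ge1 w hv; move: IH1 IH2 => /=; move: (run w v) => r IH1 IH2 hr h.
  (* Either [c] is the innermost operator, or it is a left adjoint of Box prolonging the block
     already read. *)
  have {h} [h|[hc h]] : r <= 1 \/ c /\ r <= 2.
    by case: c h {h1}; move: r hr {IH1 IH2} => [|[|[|[|[|r]]]]] //;
      rewrite /step /step_lbox /step_dia /= ?nth_nil; auto.
    by rewrite (IH1 h); exists 0, [:: c]; case: (c).
  by have [j [e [he ->]]] := IH2 h; exists j.+1, e; rewrite hc.
have h3 : run (c :: w) v <= 3 ->
    exists i j e, e \in letters /\ c :: w = nseq i false ++ nseq j true ++ e.
  have [/h2[j [e [he ->]]] _|h2' h3'] := leqP (run (c :: w) v) 2; first by exists 0, j, e.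
  move: h2' h3'; have := run_ge1 w hv; move: IH3 => /=; move: (run w v) => r IH3 hr h h'.
  have [hc hr3] : c = false /\ r <= 3.
    by case: c h h' {h1 h2}; move: r hr {IH3} => [|[|[|[|[|r]]]]] //;
      rewrite /step /step_lbox /step_dia /= ?nth_nil.
  by have [i [j [e [he ->]]]] := IH3 hr3; exists i.+1, j, e; rewrite hc.
split=> //.
have [/h3[i [j [e [he ->]]]] _|h3' h4'] := leqP (run (c :: w) v) 3.
  by exists [::], i, j, e.
move: h3' h4'; have := run_ge1 w hv; move: IH3 => /=; move: (run w v) => r IH3 hr h h'.
have hr3 : r <= 3.
  by case: c h h' {h1 h2 h3}; move: r hr {IH3} => [|[|[|[|[|r]]]]] //;
    rewrite /step /step_lbox /step_dia /= ?nth_nil.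
by have [i [j [e [he ->]]]] := IH3 hr3; exists [:: c], i, j, e; split=> //; case: (c).
Qed.

Lemma run_shapes w v N : 0 < v -> run w v <= 4 -> size w <= N -> w \in shapes N.
Proof.
move=> hv h4; have [_ _ _ /(_ h4)[e' [i [j [e [he' he ->]]]]]] := run_decomposition w hv.
rewrite !size_cat !size_nseq => hN; rewrite (catA e').
apply: allpairs_f; apply/allpairsP.
  exists (e', i); split; [exact: he'| |exact: erefl].
  by rewrite mem_iota; apply/andP; split=> //=; lia.
exists (j, e); split; [ |exact: he|exact: erefl].
by rewrite mem_iota; apply/andP; split=> //=; lia.
Qed.

Section NameWords.
Variables (CN ON FN : eqType).

(** The outermost operator comes first. In [fword] the letters stand for the order-dual operators
    (Box for Dia, right adjoint of Dia for left adjoint of Box), so that one list [shapes] serves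
    objects and features. *)
Fixpoint oword (b : oname CN ON) : seq bool :=
  match b with
  | ODia b1 => false :: oword b1
  | OLBox b1 => true :: oword b1
  | _ => [::]
  end.
Fixpoint obase (b : oname CN ON) : oname CN ON :=
  match b with ODia b1 | OLBox b1 => obase b1 | _ => b end.
Definition oapply (b : oname CN ON) (w : seq bool) : oname CN ON :=
  foldr (fun c b1 => if c then OLBox b1 else ODia b1) b w.

Fixpoint fword (y : fname CN FN) : seq bool :=
  match y with
  | FBox y1 => false :: fword y1
  | FBlk y1 => true :: fword y1
  | _ => [::]
  end.
Fixpoint fbase (y : fname CN FN) : fname CN FN :=
  match y with FBox y1 | FBlk y1 => fbase y1 | _ => y end.
Definition fapply (y : fname CN FN) (w : seq bool) : fname CN FN :=
  foldr (fun c y1 => if c then FBlk y1 else FBox y1) y w.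

Lemma obaseK b : oapply (obase b) (oword b) = b.
Proof. by elim: b => //= b ->. Qed.

Lemma fbaseK y : fapply (fbase y) (fword y) = y.
Proof. by elim: y => //= y ->. Qed.

Lemma osize_base b : osize b = size (oword b) + osize (obase b).
Proof. by elim: b => //= b ->. Qed.

Lemma fsize_base y : fsize y = size (fword y) + fsize (fbase y).
Proof. by elim: y => //= y ->. Qed.

(** The values 1 for object names and 4 for feature names make SA and SX sound: [step_box p] is at
    least 1 exactly when [p] is at least 2, which is [step_dia 1], and [step_dia p] is at most 4
    exactly when [p] is at most 3, which is [step_box 4]. Concepts keep the values 2 and 3. *)
Definition cval : concept CN -> nat := @evC CN shape_chain (fun _ => 2).
Definition oval : oname CN ON -> nat :=
  @evO CN ON shape_chain (fun _ => 1) (fun _ => 2).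
Definition fval : fname CN FN -> nat :=
  @evF CN FN shape_chain (fun _ => 4) (fun _ => 2).

Lemma cval_bound C : 2 <= cval C <= 3.
Proof.
rewrite /cval; elim: C => //= [C1 h1 C2 h2|C1 h1 C2 h2|C1 h1|C1 h1].
- by move: h1 h2; move: (evC _ C1) (evC _ C2) => /= m1 m2; lia.
- by move: h1 h2; move: (evC _ C1) (evC _ C2) => /= m1 m2; lia.
- by move: (evC _ C1) h1 => [|[|[|[|m]]]].
- by move: (evC _ C1) h1 => [|[|[|[|m]]]].
Qed.

Lemma oval_run b : oval b = run (oword b) (oval (obase b)).
Proof. by rewrite /oval; elim: b => //= b ->. Qed.

Lemma oval_base b : 1 <= oval (obase b).
Proof. by elim: b => //= C; have := cval_bound C; rewrite /oval /cval /=; lia. Qed.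

Lemma fval_le4 y : fval y <= 4.
Proof.
rewrite /fval; elim: y => //= [C|y|y].
- by have := cval_bound C; rewrite /cval; lia.
- by move: (evF _ _ y) => [|[|[|[|[|m]]]]].
- by move: (evF _ _ y) => [|[|[|[|[|m]]]]].
Qed.

(* The order-reversing map v |-> 5 - v exchanges step_dia with step_box and
   step_lbox with step_blk. *)
Lemma fval_run y : 5 - fval y = run (fword y) (5 - fval (fbase y)).
Proof.
elim: y => //= y; rewrite -/(run _ _) => <-; move: (fval_le4 y); rewrite /fval /=;
  by move: (evF _ _ y) => [|[|[|[|[|m]]]]].
Qed.

Lemma oval_shapes b N : oval b <= 4 -> size (oword b) <= N -> oword b \in shapes N.
Proof. by rewrite oval_run; apply: run_shapes; apply: oval_base. Qed.

Lemma fval_shapes y N : 1 <= fval y -> size (fword y) <= N -> fword y \in shapes N.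
Proof.
move=> h; apply: (@run_shapes _ (5 - fval (fbase y))).
  by have := fval_le4 (fbase y); lia.
by rewrite -fval_run; lia.
Qed.

Variable M : nat.
(** Every operator raises the value of an object name by one and lowers that of a feature name by
    one. An inequality between an object and a feature therefore bounds both words, once the values
    of the bases lie between [-M] and [M]. *)
Definition cdep : concept CN -> Z := @evC CN depth_chain (fun _ => 0%Z).
Definition odep : oname CN ON -> Z :=
  @evO CN ON depth_chain (fun _ => (- Z.of_nat M)%Z) (fun _ => 0%Z).
Definition fdep : fname CN FN -> Z :=
  @evF CN FN depth_chain (fun _ => Z.of_nat M) (fun _ => 0%Z).

Lemma cdep_bound C : (- Z.of_nat (csize C) <= cdep C <= Z.of_nat (csize C))%Z.
Proof.
rewrite /cdep; elim: C => //= [C1 h1 C2 h2|C1 h1 C2 h2|C1 h1|C1 h1].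
- by move: h1 h2; move: (evC _ C1) (evC _ C2) => /= m1 m2; lia.
- by move: h1 h2; move: (evC _ C1) (evC _ C2) => /= m1 m2; lia.
- by move: h1; move: (evC _ C1) => /= m1; lia.
- by move: h1; move: (evC _ C1) => /= m1; lia.
Qed.

Lemma odep_base b : odep b = (odep (obase b) + Z.of_nat (size (oword b)))%Z.
Proof.
rewrite /odep; elim: b => /= [a|C|b|b]; [lia|lia|move=> ->..];
  by move: (evO _ _ _) => /= z; lia.
Qed.

Lemma fdep_base y : fdep y = (fdep (fbase y) - Z.of_nat (size (fword y)))%Z.
Proof.
rewrite /fdep; elim: y => /= [a|C|b|b]; [lia|lia|move=> ->..];
  by move: (evF _ _ _) => /= z; lia.
Qed.

End NameWords.

(** * The assertions that occur in the tableau *)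

Section Sizes.
Variables (CN ON FN : eqType).
Implicit Types (B : tabox CN ON FN) (C D : concept CN).

Lemma size_subconcepts C : size (subconcepts C) = csize C.
Proof. by elim: C => //= [C hC D hD|C hC D hD|C ->|C ->] //; rewrite size_cat hC hD. Qed.

Lemma csize_subconcepts C D : D \in subconcepts C -> csize D <= csize C.
Proof.
elim: C => [N|C1 IH1 C2 IH2|C1 IH1 C2 IH2|C1 IH1|C1 IH1] /=;
  rewrite in_cons ?mem_cat => /predU1P[->|] //=.
- by case/orP=> [/IH1|/IH2]; lia.
- by case/orP=> [/IH1|/IH2]; lia.
- by move/IH1; lia.
- by move/IH1; lia.
Qed.

Lemma size_leaves C : size (leaves C) <= csize C.
Proof. by elim: C => //= [C hC D hD|C hC D hD|C hC|C hC]; rewrite ?size_cat ?size_map; lia. Qed.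

Lemma size_leaf C q : q \in leaves C -> size q <= csize C.
Proof.
elim: C q => [N|C1 IH1 C2 IH2|C1 IH1 C2 IH2|C1 IH1|C1 IH1] q /=.
- by rewrite inE => /eqP->.
- by rewrite mem_cat => /orP[/IH1|/IH2] h; apply: leq_trans h _; lia.
- by rewrite mem_cat => /orP[/IH1|/IH2] h; apply: leq_trans h _; lia.
- by case/mapP=> r /IH1 h ->.
- by case/mapP=> r /IH1 h ->.
Qed.

Lemma tsize_asize B t : t \in B -> tsize t <= asize B.
Proof.
rewrite /asize; elim: B => //= u B IH; rewrite inE => /predU1P[->|/IH]; lia.
Qed.

Lemma asize_bound B z : (forall t, t \in B -> tsize t <= z) -> asize B <= size B * z.
Proof.
rewrite /asize; elim: B => //= u B IH h; rewrite mulSn leq_add ?h ?mem_head //.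
by apply: IH => t tB; apply: h; rewrite inE tB orbT.
Qed.

Lemma size_asize B : size B <= asize B.
Proof. by rewrite /asize; elim: B => //= t B; rewrite /tsize; lia. Qed.

Lemma size_concepts B : size (concepts B) <= asize B.
Proof.
rewrite /asize /concepts; elim: B => //= t B IH; rewrite size_cat leq_add //.
by rewrite /tsize; case: (body t) => //= *; rewrite size_subconcepts; lia.
Qed.

Lemma csize_concepts B C :
  C \in concepts B -> exists2 t, t \in B & csize C <= tsize t.
Proof.
case/flatten_mapP=> t tB Ct; exists t => //; move: Ct; rewrite /tsize.
by case: (body t) => //= ? D /csize_subconcepts; lia.
Qed.

Lemma size_leaf_words cs n : (forall C, C \in cs -> csize C <= n) ->
  size (@leaf_words CN cs) <= size cs * n.
Proof.
rewrite /leaf_words; elim: cs => //= C cs IH h; rewrite size_cat mulSn leq_add //.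
  by rewrite (leq_trans (size_leaves C)) // h ?mem_head.
by apply: IH => D Dcs; apply: h; rewrite inE Dcs orbT.
Qed.

End Sizes.

(** * An invariant of the tableau and the finite list of its assertions *)

Section Invariant.
Variables (CN ON FN : eqType) (s : separation ON FN) (A : abox CN ON FN).
Local Notation A0 := (embed A).
Local Notation n := (abox_size A).
Local Notation cs := (concepts (embed A)).
Local Notation cs' := (map (@dualC CN) (concepts (embed A))).
Local Notation M := (2 * n + 1).
Implicit Types (B new : tabox CN ON FN) (b : oname CN ON) (y : fname CN FN).
Implicit Type t : term CN (oname CN ON) (fname CN FN).

Let cs_sub C D : C \in cs -> D \in subconcepts C -> D \in cs.
Proof. exact: concepts_sub. Qed.

Lemma csize_cs C : C \in cs -> csize C <= n.
Proof. by case/csize_concepts=> t /tsize_asize h1 h2; apply: leq_trans h2 h1. Qed.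

Lemma size_cs_leaf q : q \in leaf_words cs -> size q <= n.
Proof. by case/flatten_mapP=> C /csize_cs h /size_leaf h'; apply: leq_trans h' h. Qed.

Lemma csize_good_cs C : good cs C -> csize C <= M.
Proof. exact: csize_good size_cs_leaf csize_cs. Qed.

Definition holds_shape t : Prop :=
  @holds CN ON FN shape_chain (fun _ => 1) (fun _ => 4) (fun _ => 2) t.
Definition holds_depth t : Prop :=
  @holds CN ON FN depth_chain (fun _ => - Z.of_nat M)%Z (fun _ => Z.of_nat M)
    (fun _ => 0%Z) t.
(** Object names are read as the two roots, at which all input concepts are true, and feature names
    as the top; relational and feature assertions of the input then hold trivially.
    [holds_dual_word] exchanges the two sorts and handles Dia. *)
Definition holds_word t : Prop :=
  @holds CN ON FN word_algebra (fun _ => word_root) (fun _ _ => True)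
    (word_atom cs) t.
Definition holds_dual_word t : Prop :=
  @holds CN ON FN (opposite word_algebra) (fun _ _ => True) (fun _ => word_root)
    (word_atom cs') t.
Definition bounding t : Prop :=
  [/\ holds_shape t, holds_depth t, holds_word t & holds_dual_word t].

Lemma bounding_embed t : Pos t \in A0 -> bounding t.
Proof.
move=> h; have [u uA tu] := mem_embed_pos h.
case: u uA tu => [a x|x a|a x|a C|x C] uA tu; subst t.
- by split=> //; rewrite /holds_depth /=; lia.
- by split=> //; rewrite /holds_depth /=; lia.
- by split=> //; rewrite /holds_depth /=; lia.
- have CB : C \in cs.
    by apply/flatten_mapP; exists (Pos (OIn (ONam a) C)) => //; apply: subconcepts_refl.
  split=> //.
  + by have := cval_bound C; rewrite /cval /holds_shape /=; case: (evC _ C).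
  + have := cdep_bound C; have := csize_cs CB; rewrite /cdep /holds_depth /=.
    by move: (evC _ C) => /= z; lia.
  + by move=> p; apply: word_true_root.
- have CB : C \in cs.
    by apply/flatten_mapP; exists (Pos (FIn (FNam x) C)) => //; apply: subconcepts_refl.
  split=> //.
  + have := cval_bound C; rewrite /cval /holds_shape /=.
    by move: (evC _ C) => [|[|[|[|m]]]].
  + have := cdep_bound C; have := csize_cs CB; rewrite /cdep /holds_depth /=.
    by move: (evC _ C) => /= z; lia.
  + rewrite /holds_dual_word /= evC_opposite => p.
    by apply: word_true_root (map_f _ CB) _; apply: dual_cs_sub.
Qed.

Lemma bounding_rule B new : (forall t, Pos t \in B -> bounding t) ->
  rule s B new -> forall t, Pos t \in new -> bounding t.
Proof.
move=> h r t tn; split; apply: rule_sound r t tn => //; try by move=> u /h[].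
- by case: (s) => c /= [|[|[|[|[|p]]]]]; rewrite /step_box /step_dia /= ?nth_nil.
- by case: (s) => c /= p; lia.
(* For SA, Dia of the roots holds only at [None]: the empty word does not end in a letter, so no
   word has a Dia-edge to it. The Box-loop at [None] then places [None] in [p]. *)
- case: (s) => c //= p hp q [r hr [er|er]]; subst r.
    by case: q hr => [v|] // _; apply: (hp None (or_introl erefl) None).
  case: q hr => [v|]; first by case: v.
  by move=> _; apply: (hp None (or_introl erefl) None).
- case: (s) => c //= p hp q [r hr [er|er]]; subst r.
    by case: q hr => [v|] // _; apply: (hp None (or_introl erefl) None).
  case: q hr => [v|]; first by case: v.
  by move=> _; apply: (hp None (or_introl erefl) None).
Qed.

Definition objs : seq (oname CN ON) := flatten [seq term_obj (body u) | u <- A0].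
Definition feats : seq (fname CN FN) := flatten [seq term_feat (body u) | u <- A0].

Fixpoint wfO b : Prop :=
  match b with
  | ONam a => ONam a \in objs
  | OCls C => good cs C
  | ODia b1 | OLBox b1 => wfO b1
  end.
Fixpoint wfF y : Prop :=
  match y with
  | FNam x => FNam x \in feats
  | FCls C => good cs C
  | FBox y1 | FBlk y1 => wfF y1
  end.
Definition wf t : Prop :=
  match t with
  | RBox b y | RDia y b | Inc b y => wfO b /\ wfF y
  | OIn b C => wfO b /\ good cs C
  | FIn y C => wfF y /\ good cs C
  end.

Lemma wf_embed u : u \in A0 -> wf (body u).
Proof.
move=> uA.
have ho b : b \in term_obj (body u) -> b \in objs by move=> h; apply/flatten_mapP; exists u.
have hf y : y \in term_feat (body u) -> y \in feats by move=> h; apply/flatten_mapP; exists u.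
have hc C : C \in term_concepts (body u) -> good cs C.
  by move=> h; apply: good_in; apply/flatten_mapP; exists u.
have [t tb] : exists t : term CN ON FN, body u = embed_term t by case/mapP: uA => -[t|t] _ ->; exists t.
rewrite tb in ho hf hc *.
case: t ho hf hc {tb} => [a x|x a|a x|a C|x C] /= ho hf hc; split;
  by [apply: ho; rewrite inE|apply: hf; rewrite inE|apply: hc; apply: subconcepts_refl].
Qed.

(** Only [OCls C] needs an argument, as there a new concept [Dia C] appears. In the opposite algebra
    the hypothesis puts [evF y] inside Box of the dual of [C]; every well-formed feature contains
    [None], whose Box-edge to the empty word gives the condition of [good_dia]. *)
Lemma wf_odia b y : wfO b -> wfF y -> holds_dual_word (RDia y b) -> wfO (odia b).
Proof.
case: b => //= C gC wy; rewrite /holds_dual_word /= evC_opposite => h.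
apply: good_dia gC _; apply: (h None); last by [].
elim: y wy {h} => //= [x _|C' /(good_none_dual cs_sub)|y IH wy|y IH wy].
- by left.
- by rewrite evC_opposite.
- by exists None => //; apply: IH.
- by exists None => //; apply: IH.
Qed.

Lemma wf_fbox b y : wfO b -> wfF y -> holds_word (RBox b y) -> wfF (fbox y).
Proof.
case: y => //= C wb gC; rewrite /holds_word /= => h.
apply: good_box gC _; apply: (h None); last by [].
elim: b wb {h} => //= [x _|C' /(good_none cs_sub)|y IH wy|y IH wy] //.
- by left.
- by exists None => //; apply: IH.
- by exists None => //; apply: IH.
Qed.

Lemma odia_wf b : wfO (odia b) -> wfO b.
Proof. by case: b => //= C /(good_sub cs_sub); apply; rewrite inE subconcepts_refl orbT. Qed.

Lemma fbox_wf y : wfF (fbox y) -> wfF y.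
Proof. by case: y => //= C /(good_sub cs_sub); apply; rewrite inE subconcepts_refl orbT. Qed.

Lemma wf_concepts B C : (forall u, u \in B -> wf (body u)) ->
  C \in concepts B -> good cs C.
Proof.
move=> h /flatten_mapP[u /h]; case: (body u) => //= [b D|y D] [_ gD];
  by move=> CD; apply: (good_sub cs_sub gD CD).
Qed.

Lemma wf_rule B new : (forall u, u \in B -> wf (body u)) ->
  (forall t, Pos t \in B -> bounding t) -> rule s B new ->
  forall u, u \in new -> wf (body u).
Proof.
move=> hw hb r; case: r.
- by move=> C /(wf_concepts hw) gC u; rewrite !inE => /orP[] /eqP->.
- by move=> b y C /hw/=[wb _] /hw/=[wy _] u; rewrite inE => /eqP->.
- move=> b C1 C2 /hw/=[wb /(good_sub cs_sub) g] u.
  by rewrite !inE => /orP[] /eqP-> /=; split=> //; apply: g;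
    rewrite /= inE mem_cat subconcepts_refl ?orbT.
- move=> b C1 C2 /hw/=[wb /(good_sub cs_sub) g] u.
  by rewrite !inE => /orP[] /eqP-> /=; split=> //; apply: g;
    rewrite /= inE mem_cat subconcepts_refl ?orbT.
- by move=> b C1 C2 /hw/=[wb _] _ /(wf_concepts hw) g u; rewrite inE => /eqP->.
- by move=> b C1 C2 /hw/=[wb _] _ /(wf_concepts hw) g u; rewrite inE => /eqP->.
- by move=> b y C /hw/=[wb _] /hw/=[wy _] u; rewrite inE => /eqP->.
- by move=> b y C /hw/=[wb _] /hw/=[wy _] u; rewrite inE => /eqP->.
- move=> b y h; have /=[wb wy] := hw _ h; have [_ _ h3 _] := hb _ h.
  by move=> u; rewrite !inE => /orP[] /eqP-> /=; split=> //; apply: wf_fbox h3.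
- move=> b y h; have /=[wb wy] := hw _ h; have [_ _ _ h4] := hb _ h.
  by move=> u; rewrite !inE => /orP[] /eqP-> /=; split=> //; apply: wf_odia h4.
- by move=> b y /hw/=[wb /fbox_wf wy] u; rewrite inE => /eqP->.
- by move=> b y /hw/=[wb wy] u; rewrite inE => /eqP->.
- by move=> b y /hw/=[wb wy] u; rewrite inE => /eqP->.
- by move=> b y /hw/=[/odia_wf wb wy] u; rewrite inE => /eqP->.
- by move=> b C /hw/=[wb gC] u; rewrite inE => /eqP->.
- by move=> b C /hw/=[wb gC] u; rewrite inE => /eqP->.
- by move=> b C /hw/=[wb gC] u; rewrite inE => /eqP->.
- by move=> b C /hw/=[wb gC] u; rewrite inE => /eqP->.
- by move=> b y _ /hw/=[wb gC] u; rewrite inE => /eqP->.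
- by move=> b y _ /hw/=[wb gC] u; rewrite inE => /eqP->.
Qed.

(** Negative assertions are not controlled by the bounding algebras. A negative rule only joins a
    classifying name to a name already present in a negative assertion, so no adjoint operator is
    ever applied there. *)
Definition unmodal t : Prop :=
  (forall b, b \in term_obj t -> oword b = [::]) /\
  (forall y, y \in term_feat t -> fword y = [::]).

Lemma unmodal_rule B new : (forall t, Neg t \in B -> unmodal t) -> rule s B new ->
  forall t, Neg t \in new -> unmodal t.
Proof.
move=> h r t nt; have [[b [C [-> /h[h1 h2]]]]|[y [C [-> /h[h1 h2]]]]] := rule_neg_origin r nt.
  by split=> [b'|y]; rewrite inE => /eqP-> //; apply: h1; rewrite inE.
by split=> [b'|y']; rewrite inE => /eqP-> //; apply: h2; rewrite inE.
Qed.

Lemma unmodal_embed t : Neg t \in A0 -> unmodal t.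
Proof.
case/mem_embed_neg=> u _ ->.
by case: u => [a x|x a|a x|a C|x C]; split=> b; rewrite ?inE // => /eqP->.
Qed.

Definition invariant_tableau B : Prop :=
  [/\ forall u, u \in B -> wf (body u), forall t, Pos t \in B -> bounding t &
      forall t, Neg t \in B -> unmodal t].

Lemma invariant_embed : invariant_tableau A0.
Proof. by split; [exact: wf_embed|exact: bounding_embed|exact: unmodal_embed]. Qed.

Lemma invariant_rule B new :
  invariant_tableau B -> rule s B new -> invariant_tableau new.
Proof.
move=> [h1 h2 h3] r; split; [exact: wf_rule r|exact: bounding_rule r|].
exact: unmodal_rule r.
Qed.

Lemma invariant_cat B new : invariant_tableau new -> invariant_tableau B ->
  invariant_tableau (new ++ B).
Proof.
move=> [h1 h2 h3] [k1 k2 k3]; split=> u; rewrite mem_cat => /orP[]; auto.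
Qed.

Definition onames : seq (oname CN ON) :=
  [seq oapply b w | b <- objs ++ map OCls (good_list cs n), w <- shapes (2 * M)].
Definition fnames : seq (fname CN FN) :=
  [seq fapply y w | y <- feats ++ map FCls (good_list cs n), w <- shapes (2 * M)].

Lemma wfO_base b : wfO b -> obase b \in objs ++ map OCls (good_list cs n).
Proof.
rewrite mem_cat; elim: b => //= [a ->|C gC] //.
by rewrite map_f ?orbT //; apply: good_mem gC; apply: size_cs_leaf.
Qed.

Lemma wfF_base y : wfF y -> fbase y \in feats ++ map FCls (good_list cs n).
Proof.
rewrite mem_cat; elim: y => //= [a ->|C gC] //.
by rewrite map_f ?orbT //; apply: good_mem gC; apply: size_cs_leaf.
Qed.

Lemma mem_onames b : wfO b -> oval b <= 4 -> size (oword b) <= 2 * M -> b \in onames.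
Proof.
move=> wb h1 h2; rewrite -[b]obaseK; apply: allpairs_f; first exact: wfO_base.
exact: oval_shapes.
Qed.

Lemma mem_fnames y : wfF y -> 1 <= fval y -> size (fword y) <= 2 * M -> y \in fnames.
Proof.
move=> wy h1 h2; rewrite -[y]fbaseK; apply: allpairs_f; first exact: wfF_base.
exact: fval_shapes.
Qed.

Lemma odep_wf b : wfO b -> (Z.of_nat (size (oword b)) <= odep M b + Z.of_nat M)%Z.
Proof.
rewrite odep_base => wb.
suff : (- Z.of_nat M <= odep M (obase b))%Z by lia.
elim: b wb => //= [a _|C /csize_good_cs h]; first by rewrite /odep /=; lia.
have := cdep_bound C.
rewrite /cdep /odep /=; move: (evC _ C) => /= z; lia.
Qed.

Lemma fdep_wf y : wfF y -> (Z.of_nat (size (fword y)) <= Z.of_nat M - fdep M y)%Z.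
Proof.
rewrite fdep_base => wy.
suff : (fdep M (fbase y) <= Z.of_nat M)%Z by lia.
elim: y wy => //= [a _|C /csize_good_cs h]; first by rewrite /fdep /=; lia.
have := cdep_bound C.
rewrite /cdep /fdep /=; move: (evC _ C) => /= z; lia.
Qed.

Definition listed t : Prop :=
  [/\ forall b, b \in term_obj t -> b \in onames /\ size (oword b) <= 2 * M,
      forall y, y \in term_feat t -> y \in fnames /\ size (fword y) <= 2 * M & wf t].

(** An object value is at least 1 and a feature value at most 4, so the inequality in [shape_chain]
    bounds each from the other side as well, which is acceptance by the automaton. The inequality in
    [depth_chain] bounds the lengths of the words. *)
Lemma listed_pos t : wf t -> bounding t -> listed t.
Proof.
have ho b : wfO b -> oval b <= 4 -> (odep M b <= Z.of_nat M)%Z ->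
    b \in onames /\ size (oword b) <= 2 * M.
  move=> wb h1 h2; have h : size (oword b) <= 2 * M by have := odep_wf wb; lia.
  by split=> //; apply: mem_onames.
have hf y : wfF y -> 1 <= fval y -> (- Z.of_nat M <= fdep M y)%Z ->
    y \in fnames /\ size (fword y) <= 2 * M.
  move=> wb h1 h2; have h : size (fword y) <= 2 * M by have := fdep_wf wb; lia.
  by split=> //; apply: mem_fnames.
have go b : 1 <= oval b by rewrite oval_run; apply: run_ge1; apply: oval_base.
have dob b : wfO b -> (- Z.of_nat M <= odep M b)%Z by move=> /odep_wf; lia.
have df y : wfF y -> (fdep M y <= Z.of_nat M)%Z by move=> /fdep_wf; lia.
have dc C : good cs C -> (- Z.of_nat M <= cdep C <= Z.of_nat M)%Z.
  by move=> /csize_good_cs; have := cdep_bound C; lia.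
case: t => [b y|y b|b y|b C|y C] wt [h1 h2 _ _]; split=> //; case: wt => w1 w2.
- move=> c; rewrite inE => /eqP->.
  have k1 : oval b <= step_box (fval y) := h1.
  have k2 : (odep M b <= Z.pred (fdep M y))%Z := h2.
  apply: ho => //; last by have := df _ w2; lia.
  by have := fval_le4 y; move: k1; move: (fval y) => [|[|[|[|[|v]]]]] //= k _;
    apply: leq_trans k _.
- move=> c; rewrite inE => /eqP->.
  have k1 : oval b <= step_box (fval y) := h1.
  have k2 : (odep M b <= Z.pred (fdep M y))%Z := h2.
  apply: hf => //; last by have := dob _ w1; lia.
  by have := go b; move: k1; move: (fval y) => [|v] //=; move: (oval b) => [|v'].
- move=> c; rewrite inE => /eqP->.
  have k1 : step_dia (oval b) <= fval y := h1.
  have k2 : (Z.succ (odep M b) <= fdep M y)%Z := h2.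
  apply: ho => //; last by have := df _ w2; lia.
  have := leq_trans k1 (fval_le4 y).
  by move: (oval b) => [|[|[|[|[|v]]]]]; rewrite /step_dia /= ?nth_nil.
- move=> c; rewrite inE => /eqP->.
  have k1 : step_dia (oval b) <= fval y := h1.
  have k2 : (Z.succ (odep M b) <= fdep M y)%Z := h2.
  apply: hf => //; last by have := dob _ w1; lia.
  apply: leq_trans k1; have := go b.
  by move: (oval b) => [|[|[|[|[|v]]]]]; rewrite /step_dia /= ?nth_nil.
- move=> c; rewrite inE => /eqP->.
  have k1 : oval b <= fval y := h1.
  have k2 : (odep M b <= fdep M y)%Z := h2.
  apply: ho => //; last by have := df _ w2; lia.
  exact: leq_trans k1 (fval_le4 y).
- move=> c; rewrite inE => /eqP->.
  have k1 : oval b <= fval y := h1.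
  have k2 : (odep M b <= fdep M y)%Z := h2.
  apply: hf => //; last by have := dob _ w1; lia.
  exact: leq_trans (go b) k1.
- move=> c; rewrite inE => /eqP->.
  have k1 : oval b <= cval C := h1.
  have k2 : (odep M b <= cdep C)%Z := h2.
  apply: ho => //; last by have := dc _ w2; lia.
  by have := cval_bound C; lia.
- move=> c; rewrite inE => /eqP->.
  have k1 : cval C <= fval y := h1.
  have k2 : (cdep C <= fdep M y)%Z := h2.
  apply: hf => //; last by have := dc _ w2; lia.
  by have := cval_bound C; lia.
Qed.

Lemma listed_neg t : wf t -> unmodal t -> listed t.
Proof.
have ho b : wfO b -> oword b = [::] -> b \in onames /\ size (oword b) <= 2 * M.
  move=> wb eb; split; last by rewrite eb.
  apply: mem_onames; rewrite ?eb // oval_run eb /= leqW //.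
  elim: (b) => //= C; have := cval_bound C; rewrite /cval /oval /=.
  by move: (evC _ C) => v /andP[].
have hf y : wfF y -> fword y = [::] -> y \in fnames /\ size (fword y) <= 2 * M.
  move=> wy ey; split; last by rewrite ey.
  apply: mem_fnames; rewrite ?ey //; move: (fval_run y); rewrite ey /=.
  suff : 2 <= fval (fbase y) by have := fval_le4 y; have := fval_le4 (fbase y); lia.
  elim: (y) => //= C; have := cval_bound C; rewrite /cval /fval /=.
  by move: (evC _ C) => v /andP[].
move=> wt [h1 h2]; split=> // c hc.
  apply: ho; last exact: h1.
  by case: t wt hc {h1 h2} => [b y|y b|b y|b C|y C] [] //= w1 w2; rewrite inE => /eqP->.
apply: hf; last exact: h2.
by case: t wt hc {h1 h2} => [b y|y b|b y|b C|y C] [] //= w1 w2; rewrite inE => /eqP->.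
Qed.

Lemma invariant_listed B u : invariant_tableau B -> u \in B -> listed (body u).
Proof.
case=> h1 h2 h3; case: u => t tB; have wt := h1 _ tB.
  exact: listed_pos (h2 _ tB).
exact: listed_neg (h3 _ tB).
Qed.

Definition term_list : seq (term CN (oname CN ON) (fname CN FN)) :=
  [seq RBox b y | b <- onames, y <- fnames] ++
  [seq RDia y b | b <- onames, y <- fnames] ++
  [seq Inc b y | b <- onames, y <- fnames] ++
  [seq OIn b C | b <- onames, C <- good_list cs n] ++
  [seq FIn y C | y <- fnames, C <- good_list cs n].

Definition assertion_list : tabox CN ON FN := map Pos term_list ++ map Neg term_list.

Lemma listed_mem t : listed t -> t \in term_list.
Proof.
move=> [h1 h2 wt]; rewrite /term_list !mem_cat.
have hc C : good cs C -> C \in good_list cs n by apply: good_mem; apply: size_cs_leaf.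
case: t h1 h2 wt => [b y|y b|b y|b C|y C] h1 h2 [w1 w2].
- have [hb _] := h1 _ (mem_head _ _); have [hy _] := h2 _ (mem_head _ _).
  by apply/orP; left; apply: allpairs_f.
- have [hb _] := h1 _ (mem_head _ _); have [hy _] := h2 _ (mem_head _ _).
  apply/orP; right; apply/orP; left.
  exact: (@allpairs_f _ _ _ (fun b y => RDia y b)).
- have [hb _] := h1 _ (mem_head _ _); have [hy _] := h2 _ (mem_head _ _).
  by apply/orP; right; apply/orP; right; apply/orP; left; apply: allpairs_f.
- have [hb _] := h1 _ (mem_head _ _).
  by apply/orP; right; apply/orP; right; apply/orP; right; apply/orP; left; apply: allpairs_f => //; apply: hc.
- have [hy _] := h2 _ (mem_head _ _).
  by apply/orP; right; apply/orP; right; apply/orP; right; apply/orP; right; apply: allpairs_f => //; apply: hc.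
Qed.

Lemma invariant_mem B u : invariant_tableau B -> u \in B -> u \in assertion_list.
Proof.
move=> hB uB; have h := listed_mem (invariant_listed hB uB).
by rewrite /assertion_list mem_cat; case: u {uB} h => t h; apply/orP; [left|right]; apply: map_f.
Qed.

Lemma invariant_tsize B u : invariant_tableau B -> u \in B -> tsize u <= 6 * M + 4.
Proof.
move=> hB uB; have [h1 h2 wt] := invariant_listed hB uB.
(* At most [2 * M] operators on a base of size at most [M + 1]; two such names and the two further
   symbols of [tsize] give [6 * M + 4]. *)
have ho b : wfO b -> size (oword b) <= 2 * M -> osize b <= 3 * M + 1.
  move=> wb; rewrite osize_base.
  suff : osize (obase b) <= M + 1 by lia.
  by elim: b wb => //= [a _|C /csize_good_cs]; lia.
have hf y : wfF y -> size (fword y) <= 2 * M -> fsize y <= 3 * M + 1.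
  move=> wb; rewrite fsize_base.
  suff : fsize (fbase y) <= M + 1 by lia.
  by elim: y wb => //= [a _|C /csize_good_cs]; lia.
rewrite /tsize; case: (body u) h1 h2 wt => [b y|y b|b y|b C|y C] h1 h2 [w1 w2].
- have [_ hb] := h1 _ (mem_head _ _); have [_ hy] := h2 _ (mem_head _ _).
  by have := ho _ w1 hb; have := hf _ w2 hy; lia.
- have [_ hb] := h1 _ (mem_head _ _); have [_ hy] := h2 _ (mem_head _ _).
  by have := ho _ w1 hb; have := hf _ w2 hy; lia.
- have [_ hb] := h1 _ (mem_head _ _); have [_ hy] := h2 _ (mem_head _ _).
  by have := ho _ w1 hb; have := hf _ w2 hy; lia.
- have [_ hb] := h1 _ (mem_head _ _).
  by have := ho _ w1 hb; have := csize_good_cs w2; lia.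
- have [_ hy] := h2 _ (mem_head _ _).
  by have := hf _ w1 hy; have := csize_good_cs w2; lia.
Qed.

End Invariant.

(** * Counting concepts, names and assertions *)

Definition good_bound (n : nat) : nat := n + 2 * (n.+1 * (n * n)) * n.
(** The first factor counts the bases, names of the input or classifying names of good concepts; the
    second is the size of [shapes] for words of length at most [2 * (2 * n + 1)]. *)
Definition name_bound (n : nat) : nat :=
  (n + good_bound n) * (3 * (2 * (2 * n + 1)).+1 * ((2 * (2 * n + 1)).+1 * 3)).
Definition assertion_bound (n : nat) : nat :=
  2 * (3 * (name_bound n * name_bound n) + 2 * (name_bound n * good_bound n)).

Section Counting.
Variables (CN ON FN : eqType) (A : abox CN ON FN).
Local Notation n := (abox_size A).

Lemma size_flatten_le1 (T : eqType) (U : Type) (f : T -> seq U) (r : seq T) :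
  (forall x, size (f x) <= 1) -> size (flatten (map f r)) <= size r.
Proof. by move=> h; elim: r => //= x r IH; rewrite size_cat -add1n leq_add. Qed.

Lemma size_good_bound : size (good_list (concepts (embed A)) n) <= good_bound n.
Proof.
have h1 : size (concepts (embed A)) <= n := size_concepts _.
rewrite size_good_list leq_add // leq_mul // leq_mul2l leq_mul2l /=.
apply: leq_trans (size_leaf_words (@csize_cs _ _ _ A)) _; by rewrite leq_mul2r h1 orbT.
Qed.

Lemma size_onames : size (onames A) <= name_bound n.
Proof.
rewrite size_allpairs size_cat size_map size_shapes leq_mul2r; apply/orP; right.
apply: leq_add size_good_bound; apply: leq_trans (size_asize (embed A)).
by apply: size_flatten_le1 => u; case: (body u).
Qed.

Lemma size_fnames : size (fnames A) <= name_bound n.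
Proof.
rewrite size_allpairs size_cat size_map size_shapes leq_mul2r; apply/orP; right.
apply: leq_add size_good_bound; apply: leq_trans (size_asize (embed A)).
by apply: size_flatten_le1 => u; case: (body u).
Qed.

Lemma size_assertion_list : size (assertion_list A) <= assertion_bound n.
Proof.
have h1 := leq_mul size_onames size_fnames.
have h2 := leq_mul size_onames size_good_bound.
have h3 := leq_mul size_fnames size_good_bound.
rewrite size_cat !size_map addnn -mul2n leq_mul2l /term_list /=; move: h1 h2 h3.
move: (onames A) (fnames A) (good_list _ _) => o f g h1 h2 h3.
by rewrite !size_cat !size_allpairs; lia.
Qed.

End Counting.

(** * The running time *)

Lemma search_has_time (T : eqType) (p : T -> timed bool) r l k :
  size r <= l -> (forall x, x \in r -> (p x).2 <= k) ->
  (search_has p r).2 <= l * k.+1.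
Proof.
move=> hl h; apply: (@leq_trans (size r * k.+1)); last by rewrite leq_mul2r hl orbT.
elim: r h {hl} => //= x r IH h; have hx := h x (mem_head _ _).
have {IH} := IH (fun y hy => h y (mem_behead (s := x :: r) hy)).
by case: (p x) hx => -[] m /= hx; rewrite mulSn; lia.
Qed.

Lemma search_mem_time (T : eqType) (sz : T -> nat) x r l k m :
  size r <= l -> sz x <= m -> (forall y, y \in r -> sz y <= k) ->
  (search_mem sz x r).2 <= l * (m + k).+1.
Proof.
by move=> hl hx h; apply: search_has_time => // y /h hy /=; apply: leq_add.
Qed.

Lemma collect_bounds (T : eqType) (U : Type) (f : T -> timed (seq U)) r l k m :
  size r <= l -> (forall x, x \in r -> (f x).2 <= k /\ size (f x).1 <= m) ->
  (collect f r).2 <= l * (k + m).+1 /\ size (collect f r).1 <= l * m.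
Proof.
move=> hl h; suff [h1 h2] : (collect f r).2 <= size r * (k + m).+1 /\
    size (collect f r).1 <= size r * m.
  by split; [apply: leq_trans h1 _|apply: leq_trans h2 _]; rewrite leq_mul2r hl orbT.
elim: r h {hl} => //= x r IH h; have [h1 h2] := h x (mem_head _ _).
have {IH} [h3 h4] := IH (fun y hy => h y (mem_behead (s := x :: r) hy)).
by rewrite size_cat !mulSn; lia.
Qed.

(** * The cost of one round *)

Section Round.
Variables (CN ON FN : eqType) (s : separation ON FN) (B : tabox CN ON FN).
Variables l z : nat.
Hypothesis size_B : size B <= l.
Hypothesis tsize_B : forall t, t \in B -> tsize t <= z.
Hypothesis size_new : forall new, rule s B new ->
  size new <= 2 /\ forall t, t \in new -> tsize t <= z.

Lemma both_bounds (m1 m2 : timed (seq (tabox CN ON FN))) k1 k2 n1 n2 :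
  m1.2 <= k1 -> size m1.1 <= n1 -> m2.2 <= k2 -> size m2.1 <= n2 ->
  (both m1 m2).2 <= k1 + k2 + n1 + 1 /\ size (both m1 m2).1 <= n1 + n2.
Proof. by move=> h1 h2 h3 h4; rewrite /= size_cat; lia. Qed.

Lemma guard_bounds ok (new : tabox CN ON FN) :
  (guard ok new).2 <= ok.2 + asize new /\ size (guard ok new).1 <= 1.
Proof. by case: ok => -[] k /=; lia. Qed.

Lemma osize_odia (b : oname CN ON) : osize (odia b) = (osize b).+1.
Proof. by case: b. Qed.

Lemma fsize_fbox (y : fname CN FN) : fsize (fbox y) = (fsize y).+1.
Proof. by case: y. Qed.

Lemma obj_instances_bounds (b : oname CN ON) (y : fname CN FN) :
  (obj_instances b y).2 <= 2 * (osize b + fsize y) + 10 /\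
  size (obj_instances b y).1 <= 2.
Proof.
rewrite /obj_instances.
have h1 : (if odia_inv b is Some b1 then emit [:: Pos (RDia y b1)] else ret [::]).2
    <= osize b + fsize y + 2 /\
    size (if odia_inv b is Some b1 then emit [:: Pos (RDia y b1)]
          else ret [::] : timed (seq (tabox CN ON FN))).1 <= 1.
  case E: (odia_inv b) => [b1|] //; move/odia_invP: E => ->.
  by rewrite osize_odia /= /asize /tsize /=; lia.
have h2 : (match b with
    | OLBox b1 => emit [:: Pos (RBox b1 y)]
    | OCls C => emit [:: Pos (FIn y C)]
    | _ => ret [::] : timed (seq (tabox CN ON FN))
    end).2 <= osize b + fsize y + 2 /\
    size (match b with
    | OLBox b1 => emit [:: Pos (RBox b1 y)]
    | OCls C => emit [:: Pos (FIn y C)]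
    | _ => ret [::] : timed (seq (tabox CN ON FN))
    end).1 <= 1.
  by case: (b) => //= *; rewrite /asize /tsize /=; lia.
case: h1 h2 => [h1 h1'] [h2 h2']; have [h h'] := both_bounds h1 h1' h2 h2'.
by split; [apply: leq_trans h _; lia|apply: leq_trans h' _].
Qed.

Lemma feat_instances_bounds (b : oname CN ON) (y : fname CN FN) :
  (feat_instances b y).2 <= 2 * (osize b + fsize y) + 10 /\
  size (feat_instances b y).1 <= 2.
Proof.
rewrite /feat_instances.
have h1 : (if fbox_inv y is Some y1 then emit [:: Pos (RBox b y1)] else ret [::]).2
    <= osize b + fsize y + 2 /\
    size (if fbox_inv y is Some y1 then emit [:: Pos (RBox b y1)]
          else ret [::] : timed (seq (tabox CN ON FN))).1 <= 1.
  case E: (fbox_inv y) => [y1|] //; move/fbox_invP: E => ->.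
  by rewrite fsize_fbox /= /asize /tsize /=; lia.
have h2 : (match y with
    | FBlk y1 => emit [:: Pos (RDia y1 b)]
    | FCls C => emit [:: Pos (OIn b C)]
    | _ => ret [::] : timed (seq (tabox CN ON FN))
    end).2 <= osize b + fsize y + 2 /\
    size (match y with
    | FBlk y1 => emit [:: Pos (RDia y1 b)]
    | FCls C => emit [:: Pos (OIn b C)]
    | _ => ret [::] : timed (seq (tabox CN ON FN))
    end).1 <= 1.
  by case: (y) => //= *; rewrite /asize /tsize /=; lia.
case: h1 h2 => [h1 h1'] [h2 h2']; have [h h'] := both_bounds h1 h1' h2 h2'.
by split; [apply: leq_trans h _; lia|apply: leq_trans h' _].
Qed.

Lemma instances1_bounds (t : assertion CN (oname CN ON) (fname CN FN)) :
  (instances1 s t).2 <= 10 * tsize t + 30 /\ size (instances1 s t).1 <= 4.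
Proof.
case: t => [] [b y|y b|b y|b C|y C]; rewrite /instances1.
- have h1 : (emit [:: Pos (Inc (OLBox b) y); Pos (Inc b (fbox y))] :
      timed (seq (tabox CN ON FN))).2 <= 2 * (osize b + fsize y) + 6.
    by rewrite /= /asize /tsize /= fsize_fbox; lia.
  have h2 : (if s is SA b0 then
      guard (compare (@osize CN ON) b (ONam b0)) [:: Pos (RDia y b)]
      else ret [::] : timed (seq (tabox CN ON FN))).2 <= 2 * (osize b + fsize y) + 3 /\
    size (if s is SA b0 then
      guard (compare (@osize CN ON) b (ONam b0)) [:: Pos (RDia y b)]
      else ret [::] : timed (seq (tabox CN ON FN))).1 <= 1.
    case: (s) => // b0; have [] := guard_bounds (compare (@osize CN ON) b (ONam b0))
      [:: Pos (RDia y b)]; rewrite /= /asize /tsize /=; lia.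
  case: h2 => h2 h2'; have [h h'] := both_bounds h1 (leqnn 1) h2 h2'.
  by split; [apply: leq_trans h _; rewrite /tsize /=; lia|apply: leq_trans h' _].
- have h1 : (emit [:: Pos (Inc (odia b) y); Pos (Inc b (FBlk y))] :
      timed (seq (tabox CN ON FN))).2 <= 2 * (osize b + fsize y) + 6.
    by rewrite /= /asize /tsize /= osize_odia; lia.
  have h2 : (if s is SX y0 then
      guard (compare (@fsize CN FN) y (FNam y0)) [:: Pos (RBox b y)]
      else ret [::] : timed (seq (tabox CN ON FN))).2 <= 2 * (osize b + fsize y) + 3 /\
    size (if s is SX y0 then
      guard (compare (@fsize CN FN) y (FNam y0)) [:: Pos (RBox b y)]
      else ret [::] : timed (seq (tabox CN ON FN))).1 <= 1.
    case: (s) => // y0; have [] := guard_bounds (compare (@fsize CN FN) y (FNam y0))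
      [:: Pos (RBox b y)]; rewrite /= /asize /tsize /=; lia.
  case: h2 => h2 h2'; have [h h'] := both_bounds h1 (leqnn 1) h2 h2'.
  by split; [apply: leq_trans h _; rewrite /tsize /=; lia|apply: leq_trans h' _].
- have [h1 h1'] := obj_instances_bounds b y.
  have [h2 h2'] := feat_instances_bounds b y.
  have [h h'] := both_bounds h1 h1' h2 h2'.
  by split; [apply: leq_trans h _; rewrite /tsize /=; lia|apply: leq_trans h' _].
- by case: C => //= *; rewrite /asize /tsize /=; lia.
- by case: C => //= *; rewrite /asize /tsize /=; lia.
- by [].
- by [].
- by [].
- by rewrite /= /asize /tsize /=; lia.
- by rewrite /= /asize /tsize /=; lia.
Qed.

Lemma instances2_bounds cs k (t u : assertion CN (oname CN ON) (fname CN FN)) :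
  size cs <= k -> (forall C, C \in cs -> csize C <= z) ->
  tsize t <= z -> tsize u <= z ->
  (instances2 cs t u).2 <= 20 * z + 20 + k * (3 * z + 2) /\
  size (instances2 cs t u).1 <= 3.
Proof.
move=> hk hc.
have mem_time (E : concept CN) : csize E <= 2 * z + 1 ->
    (search_mem (@csize CN) E cs).2 <= k * (3 * z + 2).
  move=> hE; have := search_mem_time hk hE hc.
  by have -> : (2 * z + 1 + z).+1 = 3 * z + 2 by lia.
case: t => [] // [] // b C ht; case: u => [] // [] // y D hu; move: ht hu;
  rewrite {1 2}/tsize /= => ht hu.
- case: eqP => _ /=; last by lia.
  have := mem_time (Meet C D).
  have [] := guard_bounds (search_mem (@csize CN) (Meet C D) cs)
    [:: Pos (OIn b (Meet C D)) : assertion CN (oname CN ON) (fname CN FN)].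
  by rewrite /guard /= /asize /tsize /=; lia.
- have [h1 h1'] := guard_bounds (compare (@csize CN) C D)
    [:: Pos (Inc b y) : assertion CN (oname CN ON) (fname CN FN)].
  have [h2 h2'] : (if C is Box C1 then
       guard (compare (@csize CN) C1 D) [:: Pos (RBox b y)] else ret [::] :
       timed (seq (tabox CN ON FN))).2 <= 4 * z /\
     size (if C is Box C1 then
       guard (compare (@csize CN) C1 D) [:: Pos (RBox b y)] else ret [::] :
       timed (seq (tabox CN ON FN))).1 <= 1.
    case: (C) ht => //= C1 ht.
    have [] := guard_bounds (compare (@csize CN) C1 D)
      [:: Pos (RBox b y) : assertion CN (oname CN ON) (fname CN FN)].
    by rewrite /guard /= /asize /tsize /=; lia.
  have [h3 h3'] : (if D is Dia D1 then
       guard (compare (@csize CN) C D1) [:: Pos (RDia y b)] else ret [::] :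
       timed (seq (tabox CN ON FN))).2 <= 4 * z /\
     size (if D is Dia D1 then
       guard (compare (@csize CN) C D1) [:: Pos (RDia y b)] else ret [::] :
       timed (seq (tabox CN ON FN))).1 <= 1.
    case: (D) hu => //= D1 hu.
    have [] := guard_bounds (compare (@csize CN) C D1)
      [:: Pos (RDia y b) : assertion CN (oname CN ON) (fname CN FN)].
    by rewrite /guard /= /asize /tsize /=; lia.
  have [h4 h4'] := both_bounds h2 h2' h3 h3'.
  have [h5 h5'] := both_bounds h1 h1' h4 h4'.
  split; last exact: h5'.
  by apply: leq_trans h5 _; rewrite /= /asize /tsize /=; lia.
- case: eqP => _ /=; last by lia.
  have := mem_time (Join C D).
  have [] := guard_bounds (search_mem (@csize CN) (Join C D) cs)
    [:: Pos (FIn b (Join C D)) : assertion CN (oname CN ON) (fname CN FN)].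
  by rewrite /guard /= /asize /tsize /=; lia.
Qed.

(** The expression follows the nesting of [both] and [collect] in [instances], with at most [l * z]
    concepts, [l] assertions and [l * l] pairs. *)
Definition instances_time : nat :=
  l * z + (l * z * (4 * z + 6 + 1).+1 +
    (l * (10 * z + 30 + 4).+1 +
     l * (l * (20 * z + 20 + l * z * (3 * z + 2) + 3).+1 + l * 3).+1 + l * 4 + 1) +
    l * z * 1 + 1).

Lemma instances_bounds : (instances s B).2 <= instances_time /\
  size (instances s B).1 <= l * z * 1 + (l * 4 + l * (l * 3)).
Proof.
have ha : asize B <= l * z.
  by apply: leq_trans (asize_bound tsize_B) _; rewrite leq_mul2r size_B orbT.
have hk : size (concepts B) <= l * z := leq_trans (size_concepts B) ha.
have hc C : C \in concepts B -> csize C <= z.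
  by case/csize_concepts=> t /tsize_B h1 h2; apply: leq_trans h2 h1.
have [h1 h1'] := @collect_bounds _ _
  (fun C => emit [:: Pos (OIn (OCls C) C); Pos (FIn (FCls C) C)]
     : timed (seq (tabox CN ON FN))) (concepts B) (l * z) (4 * z + 6) 1 hk
  ltac:(by move=> C /hc; rewrite /= /asize /tsize /=; lia).
have [h2 h2'] := @collect_bounds _ _ (instances1 s) B l (10 * z + 30) 4 size_B
  ltac:(by move=> t /tsize_B ht; have := instances1_bounds t; lia).
have [h3 h3'] := @collect_bounds _ _
  (fun t => collect (instances2 (concepts B) t) B) B l _ _ size_B
  (fun t ht => collect_bounds size_B (fun u hu =>
     instances2_bounds hk hc (tsize_B ht) (tsize_B hu))).
have [h4 h4'] := both_bounds h2 h2' h3 h3'.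
have [h5 h5'] := both_bounds h1 h1' h4 h4'.
split; last exact: h5'.
by rewrite /instances_time leq_add.
Qed.

(** The clash search, the listing of the instances, and the test of each instance for a new
    conclusion; the factor 2 is the maximal number of conclusions of a rule. *)
Definition round_bound : nat :=
  (l * (l * (z + z).+1).+1 +
   (instances_time + (l * z * 1 + (l * 4 + l * (l * 3))) *
      (2 * (l * (z + z).+1).+1 + 1).+1)).+1.

Lemma round_time_bound : round_time s B <= round_bound.
Proof.
rewrite /round_time /round_bound ltnS leq_add //.
  apply: search_has_time => // -[u|u] uB //=; case: ifP => // _.
  by apply: search_mem_time => //; have := tsize_B uB.
have [h1 h2] := instances_bounds.
rewrite leq_add //.
have [] := @collect_bounds _ _ (fun new => bind (is_new B new) (fun v : bool =>
    ret (if v then [:: new] else [::]))) _ _ (2 * (l * (z + z).+1).+1) 1 h2 => //.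
move=> new /mem_instances/size_new[hn ht]; split; last by rewrite /=; case: (is_new B new).1.
rewrite /= addn0; apply: search_has_time => // t /ht tz; rewrite /= addn0.
exact: search_mem_time.
Qed.

End Round.

Lemma rule_size (CN ON FN : eqType) (s : separation ON FN) (B new : tabox CN ON FN) :
  rule s B new -> size new <= 2.
Proof. by case. Qed.

(** * Closure properties of polynomially bounded functions *)

Definition polyb (f : nat -> nat) : Prop :=
  exists c k, forall n, f n <= c * n ^ k + c.

Lemma expn_mono n i j : i <= j -> n ^ i <= n ^ j + 1.
Proof.
case: n => [|n] h; first by case: i h => [|i] _; rewrite ?expn0 ?leq_addl // exp0n.
by rewrite (leq_trans (leq_pexp2l _ h)) // leq_addr.
Qed.

Lemma polyb_const c : polyb (fun _ => c).
Proof. by exists c, 0 => n; rewrite expn0; lia. Qed.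

Lemma polyb_id : polyb (fun n => n).
Proof. by exists 1, 1 => n; rewrite expn1; lia. Qed.

Lemma polyb_add f g : polyb f -> polyb g -> polyb (fun n => f n + g n).
Proof.
move=> [c [i hf]] [d [j hg]]; exists (2 * (c + d)), (i + j) => n.
have h1 := expn_mono n (leq_addr j i); have h2 := expn_mono n (leq_addl i j).
have k1 : c * n ^ i <= c * (n ^ (i + j) + 1) by rewrite leq_mul2l h1 orbT.
have k2 : d * n ^ j <= d * (n ^ (i + j) + 1) by rewrite leq_mul2l h2 orbT.
move: (hf n) (hg n) k1 k2; move: (n ^ i) (n ^ j) (n ^ (i + j)) => x y t; nia.
Qed.

Lemma polyb_mul f g : polyb f -> polyb g -> polyb (fun n => f n * g n).
Proof.
move=> [c [i hf]] [d [j hg]]; exists (4 * (c * d)), (i + j) => n.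
apply: leq_trans (leq_mul (hf n) (hg n)) _.
have h1 := expn_mono n (leq_addr j i); have h2 := expn_mono n (leq_addl i j).
have h3 : n ^ i * n ^ j = n ^ (i + j) by rewrite expnD.
have -> : (c * n ^ i + c) * (d * n ^ j + d) =
    c * d * (n ^ i * n ^ j + n ^ i + n ^ j + 1) by lia.
rewrite h3; have -> : 4 * (c * d) * n ^ (i + j) + 4 * (c * d) =
    c * d * (4 * n ^ (i + j) + 4) by lia.
by rewrite leq_mul2l; apply/orP; right; lia.
Qed.

Lemma polyb_succ f : polyb f -> polyb (fun n => (f n).+1).
Proof.
move=> /polyb_add/(_ (polyb_const 1)) [c [k h]].
by exists c, k => n; rewrite -addn1.
Qed.

(** One round for each possible assertion and a last one that halts. With at most two conclusions
    per round, duplicates included, the ABox never exceeds [n + 2 * assertion_bound n] entries. *)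
Definition time_bound (n : nat) : nat :=
  (assertion_bound n).+1 *
  round_bound (n + 2 * assertion_bound n) (6 * (2 * n + 1) + 4).

Lemma polyb_time_bound : polyb time_bound.
Proof.
have pb : polyb assertion_bound.
  rewrite /assertion_bound /name_bound /good_bound.
  by repeat first [apply: polyb_const | apply: polyb_id | apply: polyb_succ
    | apply: polyb_add | apply: polyb_mul].
rewrite /time_bound /round_bound /instances_time.
by repeat first [apply: pb | apply: polyb_const | apply: polyb_id | apply: polyb_succ
    | apply: polyb_add | apply: polyb_mul].
Qed.

(** * Termination within the time bound and correctness *)

Section Decision.
Variables (CN ON FN : eqType) (s : separation ON FN) (A : abox CN ON FN).
Local Notation n := (abox_size A).
Local Notation R := (round_bound (n + 2 * assertion_bound n) (6 * (2 * n + 1) + 4)).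

Lemma invariant_reaches B t : reaches s (embed A) B t -> invariant_tableau A B.
Proof.
elim=> {B t} [|B t new _ hB _ [r _]]; first exact: invariant_embed.
by apply: invariant_cat => //; apply: invariant_rule r.
Qed.

Lemma size_undup_bound B t :
  reaches s (embed A) B t -> size (undup B) <= assertion_bound n.
Proof.
move=> /invariant_reaches hB; apply: leq_trans (size_assertion_list A).
apply: uniq_leq_size (undup_uniq B) _ => u; rewrite mem_undup; exact: invariant_mem.
Qed.

(** A round may add conclusions already present; progress is therefore measured on distinct
    assertions. *)
Lemma size_undup_new (T : eqType) (new B : seq T) :
  has (fun t => t \notin B) new -> size (undup B) < size (undup (new ++ B)).
Proof.
case/hasP=> t tn tB; have u : uniq (t :: undup B) by rewrite /= mem_undup tB undup_uniq.
apply: (uniq_leq_size u) => x; rewrite inE !mem_undup mem_cat.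
by case/predU1P=> [->|->]; rewrite ?tn ?orbT.
Qed.

(* Each round adds a new assertion, so the rounds are at most as many as the
   distinct assertions. *)
Lemma reaches_time B t : reaches s (embed A) B t ->
  exists r, [/\ t <= r * R, size B <= n + 2 * r & r <= size (undup B)].
Proof.
elim=> {B t} [|B t new hr [r [h1 h2 h3]] _ [rl nw]].
  by exists 0; split=> //; rewrite muln0 addn0; apply: size_asize.
have hB := invariant_reaches hr; have hu := size_undup_bound hr.
exists r.+1; split.
- rewrite mulSn addnC leq_add //; apply: round_time_bound.
  + by apply: leq_trans h2 _; lia.
  + by move=> u; apply: invariant_tsize hB.
  + move=> new' rl'; split; first exact: rule_size rl'.
    by move=> u; apply: (invariant_tsize (invariant_rule hB rl')).
- by rewrite size_cat; have := rule_size rl; lia.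
- exact: leq_ltn_trans h3 (size_undup_new nw).
Qed.

Lemma round_reaches B t :
  reaches s (embed A) B t -> t + round_time s B <= time_bound n.
Proof.
move=> hr; have [r [h1 h2 h3]] := reaches_time hr.
have hB := invariant_reaches hr; have hu := size_undup_bound hr.
rewrite /time_bound mulSn addnC leq_add //.
  apply: round_time_bound.
  + by apply: leq_trans h2 _; lia.
  + by move=> u; apply: invariant_tsize hB.
  + move=> new' rl'; split; first exact: rule_size rl'.
    by move=> u; apply: (invariant_tsize (invariant_rule hB rl')).
by apply: leq_trans h1 _; rewrite leq_mul2r (leq_trans h3 hu) orbT.
Qed.

Lemma reaches_halted : exists B t, reaches s (embed A) B t /\ halted s B.
Proof.
suff h k B t : reaches s (embed A) B t -> time_bound n - t <= k ->
    exists B t, reaches s (embed A) B t /\ halted s B.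
  exact: (h _ _ _ (reaches_start s (embed A)) (leqnn _)).
(* Induction on the time left: a round costs at least 1, and a reached ABox always leaves time for
   one more round. *)
elim: k B t => [|k IH] B t hr hk.
  by have := round_reaches hr; rewrite /round_time; lia.
have [hh|nh] := pselect (halted s B); first by exists B, t.
have ncl : ~ clash B by move=> cl; apply: nh; left.
have [new ap] : exists new, applicable s B new.
  by apply/not_existsP => na; apply: nh; right.
apply: IH (reaches_round hr ncl ap) _.
by have := round_reaches hr; rewrite /round_time; lia.
Qed.

Lemma tableau_decides T : time_bound n <= T -> decides_within s A T.
Proof.
move=> hT; split; first by move=> B t /round_reaches h; apply: leq_trans h hT.
  exact: reaches_halted.
move=> B t hr hh; split; first exact: clash_inconsistent hr.
case: hh => // nap ncons; have [//|ncl] := pselect (clash B).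
by case: ncons; apply: saturated_consistent hr ncl nap.
Qed.

End Decision.

Theorem theorem3 (CN ON FN : eqType) :
  exists c k : nat,
    (forall (A : abox CN ON FN) (b : ON), obj_occurs b A ->
       decides_within (SA b) A (c * abox_size A ^ k + c)) /\
    (forall (A : abox CN ON FN) (y : FN), feat_occurs y A ->
       decides_within (SX y) A (c * abox_size A ^ k + c)).
Proof.
have [c [k h]] := polyb_time_bound.
by exists c, k; split=> A b _; apply: tableau_decides.
Qed.
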